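(* Let $\nu\in\mathcal P_2(\mathbb R)$ and $g_0\in D_c$. Let $g$ be the strong solution of the Cauchy problem $\partial_t g(t)\in-\partial F_\nu(g(t))$, $t\in(0,\infty)$, $g(0)=g_0$. Then the following holds true: i) $g(t)\in D_c$ for all $t\ge0$. ii) The ranges fulfill $\overline{g(t_1)(0,1)}\subseteq\overline{g(t_2)(0,1)}$ for all $0\le t_1\le t_2$.
   Context: $\mathcal P_2(\mathbb R)$ is the set of Borel probability measures on $\mathbb R$ with finite second moment. For a probability measure $\mu$ on $\mathbb R$: $R_\mu^+(x) := \mu((-\infty,x])$ and $Q_\mu(s) := \min\{x \in \mathbb R : R_\mu^+(x) \ge s\}$, $s\in(0,1)$. $\mathcal C(0,1) := \{ f \in L_2(0,1) : f \text{ is non-decreasing (a.e.)}\}$ is the set of (classes of) quantile functions of measures in $\mathcal P_2(\mathbb R)$; each element is identified with its unique left-continuous non-decreasing representative, so that it is defined everywhere on $(0,1)$. $D_c := \{Q_\mu\in\mathcal C(0,1) : Q_\mu \text{ is continuous}\}$ (equivalently, $\operatorname{supp}\mu$ is convex). $g(t)(0,1)$ denotes the image of $(0,1)$ under $g(t)$. $F_\nu\colon L_2(0,1)\to\mathbb R$, $F_\nu(u) = \int_0^1 \big( (1-2s)\,u(s) + \int_0^1 |u(s)-Q_\nu(t)|\,dt \big) ds$, with subdifferential $\partial F(u) := \{ v \in L_2(0,1) : F(w) \ge F(u) + \langle v, w-u\rangle + o(\|w-u\|) \text{ for all } w \}$ (for convex $F$ the $o$-term can be omitted). A strong solution of the Cauchy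 problem is a function $g \in W^1_1((0,T];L_2(0,1)) \cap C([0,\infty);L_2(0,1))$ for every $T>0$, satisfying the initial condition and, for a.e. $t>0$, the inclusion, with $\partial_t g(t)$ the strong derivative; it exists, is unique, and takes values in $\mathcal C(0,1)$. *)

(* Defs.v *)
From HB Require Import structures.
From mathcomp Require Import all_boot all_order all_algebra.
From mathcomp Require Import all_classical all_reals all_analysis.

Set Implicit Arguments.
Unset Strict Implicit.
Unset Printing Implicit Defensive.

Import Order.TTheory GRing.Theory Num.Theory.
Import numFieldNormedType.Exports.

Local Open Scope classical_set_scope.
Local Open Scope ring_scope.

Definition lebesgue01 (R : realType) :
    {measure set (measurableTypeR R) -> \bar R} :=
  mrestr (@lebesgue_measure R) (@measurable_itv R `]0, 1[).

(* Elements of L_2(0,1) are represented by square-integrable functions; two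
   functions denote the same class when they agree a.e. on (0,1), and every
   notion below is invariant under this equivalence. *)
Notation L2 R := (LfunType (lebesgue01 R) (lee1n 2)).

Definition L2norm (R : realType) (f : L2 R) : R :=
  fine 'N[lebesgue01 R]_2%:E[EFin \o f]%E.

Definition L2inner (R : realType) (f g : L2 R) : R :=
  \int[lebesgue01 R]_s (f s * g s).

Definition finite_second_moment (R : realType)
    (mu : probability (measurableTypeR R) R) : Prop :=
  (\int[mu]_x (x ^+ 2)%:E < +oo)%E.

Definition Rplus (R : realType) (mu : probability (measurableTypeR R) R)
  (x : R) : \bar R := mu `]-oo, x]%classic.

(* For 0 < s < 1 the infimum is a minimum, since Rplus mu is right-continuous
   with limits 0 and 1. *)
Definition quantile (R : realType) (mu : probability (measurableTypeR R) R)
  (s : R) : R := inf [set x | (s%:E <= Rplus mu x)%E].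

Definition Dc (R : realType) : set (L2 R) :=
  [set f | exists mu : probability (measurableTypeR R) R,
    [/\ finite_second_moment mu,
        (f : R -> R) = quantile mu %[ae lebesgue01 R] &
        {in `]0, 1[, continuous (quantile mu)}]].

Definition is_left_cont_rep (R : realType) (f : L2 R) (q : R -> R) : Prop :=
  [/\ {in `]0, 1[ &, {homo q : x y / x <= y}},
      {in `]0, 1[, forall s, q x @[x --> s^'-] --> q s} &
      (f : R -> R) = q %[ae lebesgue01 R]].

(* The values on (0,1) are uniquely determined as soon as f is a.e. equal to a
   non-decreasing function; otherwise, and outside (0,1), they are junk. *)
Definition left_cont_rep (R : realType) (f : L2 R) : R -> R :=
  xget (cst 0) [set q | is_left_cont_rep f q].

Definition F_ (R : realType) (nu : probability (measurableTypeR R) R)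
    (u : L2 R) : R :=
  \int[lebesgue01 R]_s
    ((1 - 2 * s) * u s + \int[lebesgue01 R]_t `|u s - quantile nu t|).

(* The term o(||w - u||) is spelled out with an arbitrary slope e > 0. *)
Definition subdifferential (R : realType) (F : L2 R -> R) (u : L2 R) :
    set (L2 R) :=
  [set v | forall e : R, 0 < e -> exists2 d : R, 0 < d &
    forall w : L2 R, L2norm (w - u) < d ->
      F u + L2inner v (w - u) - e * L2norm (w - u) <= F w].

Record simple_L2 (R : realType) := SimpleL2 {
  simple_size : nat;
  simple_set : 'I_simple_size -> set (measurableTypeR R);
  simple_val : 'I_simple_size -> L2 R;
  simple_meas : forall i, measurable (simple_set i)
}.

Definition simple_fun (R : realType) (s : simple_L2 R) (t : R) : L2 R :=
  \sum_(i < simple_size s) \1_(simple_set i) t *: simple_val i.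

Definition simple_int (R : realType) (D : set R) (s : simple_L2 R) : L2 R :=
  \sum_(i < simple_size s)
    fine (lebesgue_measure (simple_set i `&` D)) *: simple_val i.

Definition strongly_measurable (R : realType) (D : set R) (f : R -> L2 R) :
    Prop :=
  exists s : (simple_L2 R)^nat,
    {ae lebesgue_measure, forall t : R, D t ->
      L2norm (f t - simple_fun (s n) t) @[n --> \oo] --> (0 : R)}.

(* Bochner integral over D, for D of finite Lebesgue measure. *)
Definition has_Bochner_integral (R : realType) (D : set R) (f : R -> L2 R)
    (I : L2 R) : Prop :=
  strongly_measurable D f /\
  exists s : (simple_L2 R)^nat,
    (\int[lebesgue_measure]_(t in D) (L2norm (f t - simple_fun (s n) t))%:E
        @[n --> \oo] --> 0)%E /\
    L2norm (simple_int D (s n) - I) @[n --> \oo] --> (0 : R).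

Definition Bochner_integrable (R : realType) (D : set R) (f : R -> L2 R) :
    Prop :=
  exists I : L2 R, has_Bochner_integral D f I.

Definition test_function (R : realType) (T : R) (phi : R -> R) : Prop :=
  (forall n x, derivable (derive1n n phi) x 1) /\
  exists a b : R, [/\ 0 < a, b < T & forall x, x \notin `[a, b] -> phi x = 0].

(* Bochner-Sobolev space W^1_1((0,T]; L_2(0,1)), with v the weak derivative. *)
Definition W11 (R : realType) (T : R) (g : R -> L2 R) : Prop :=
  Bochner_integrable `]0, T] g /\
  exists2 v : R -> L2 R, Bochner_integrable `]0, T] v &
    forall phi, test_function T phi -> exists I : L2 R,
      has_Bochner_integral `]0, T] (fun t => derive1 phi t *: g t) I /\
      has_Bochner_integral `]0, T] (fun t => phi t *: v t) (- I).

Definition is_strong_derivative (R : realType) (g : R -> L2 R) (t : R)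
    (v : L2 R) : Prop :=
  L2norm (h^-1 *: (g (t + h) - g t) - v) @[h --> 0^'] --> (0 : R).

(* Only the values of g on [0, +oo) matter. *)
Definition strong_solution (R : realType) (F : L2 R -> R) (g0 : L2 R)
    (g : R -> L2 R) : Prop :=
  [/\ forall T : R, 0 < T -> W11 T g,
      forall t : R, 0 <= t ->
        L2norm (g s - g t) @[s --> within `[0, +oo[ (nbhs t)] --> (0 : R),
      (g 0 : R -> R) = g0 %[ae lebesgue01 R] &
      {ae lebesgue_measure, forall t : R, 0 < t ->
        exists2 v : L2 R, is_strong_derivative g t v &
          subdifferential F (g t) (- v)}].

(* Main.v *)
Require Import Defs.
From HB Require Import structures.
From mathcomp Require Import all_boot all_order all_algebra.
From mathcomp Require Import all_classical all_reals all_analysis.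
From mathcomp Require Import measurable_realfun lebesgue_integral_differentiation.
From mathcomp Require Import ring lra.

(** The energy of [u] is the integral over (0,1) of [(1 - 2 s) u(s) + E (u s)],
    where [E x] is the mean distance from [x] to nu, a convex function with
    Lipschitz constant 1. The gradient flow therefore decouples: each level [s]
    moves on the line by its own scalar inclusion. Two consequences of this
    shape carry the proof.

    First, the velocity of the level [s] lies between [- 2 (1 - s)] and [2 s],
    because [E] is 1-Lipschitz ([subdifferential_bound],
    [solution_increment_signed]). Levels close to 1 hardly move down and levels
    close to 0 hardly move up. Once the ranges are known to be intervals, they
    can thus only grow ([closure_image_le]).

    Secondly, the convexity of [E] makes the distance between the levels [s] and
    [s + h] increase at the rate [2 h] at most, and keeps them ordered
    ([subdifferential_shift], [solution_modulus]):
    [0 <= g_t (s + h) - g_t s <= g_0 (s + h) - g_0 s + 2 h t] for [0 < h].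
    A continuous initial datum therefore stays continuous.

    Single levels have no meaning in [L2], so the comparison is carried out with
    test functions. A subgradient is tested with a function [p] that is
    transported from [s] to [s + h], and the inequality between the two levels
    is proved by showing that the square norm of its violation grows at most
    quadratically in the length of a time step, hence not at all
    ([nonincreasing_of_quadratic]).

    The inclusion holds at almost every time only. What turns it into a
    statement on displacements is the membership in [W11]: smooth approximations
    of the indicator of a time interval show that [<phi, g t>] is the integral of
    its weak derivative, and the latter is the pairing of [phi] with the strong
    derivative almost everywhere ([Bochner_scalarize], [weak_derivative_FTC],
    [strong_solution_increment]).

    Finally, Lebesgue differentiation converts inequalities that hold for every
    [h] and almost every [s] into inequalities between any two points of a set
    of full measure ([L2_nondecreasing_ae]). They extend to a continuous function
    on (0,1), which is the quantile function of its own law under the uniform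
    distribution ([modulus_extension], [quantile_pushforward]). *)

Set Implicit Arguments.
Unset Strict Implicit.
Unset Printing Implicit Defensive.
Import Order.TTheory GRing.Theory Num.Theory.
Import numFieldNormedType.Exports.
Local Open Scope classical_set_scope.
Local Open Scope ring_scope.

(** * Square-integrable functions on the unit interval *)

Section L2basics.
Context {R : realType}.
Notation m01 := (lebesgue01 R).
Notation int01 f := (m01.-integrable setT (EFin \o f)).

Lemma lebesgue01E (A : set R) : m01 A = lebesgue_measure (A `&` `]0, 1[).
Proof. by []. Qed.

Lemma lebesgue01T : m01 setT = 1%E.
Proof. by rewrite lebesgue01E setTI lebesgue_measure_itv/= lte01 oppr0 adde0. Qed.

Lemma L2_mem (f : L2 R) : (f : R -> R) \in Lfun m01 2%:E.
Proof. exact: LfunP. Qed.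

Lemma L2_meas (f : L2 R) : measurable_fun setT (f : R -> R).
Proof. by have := L2_mem f; rewrite inE => /andP[]; rewrite inE. Qed.

Lemma L2_int (f : L2 R) : int01 (f : R -> R).
Proof.
apply/Lfun1_integrable/Lfun_subset12; last exact: L2_mem.
by rewrite lebesgue01T.
Qed.

Lemma L2_intM (f g : L2 R) : int01 (fun s => f s * g s).
Proof. by apply/Lfun1_integrable; exact: Lfun2_mul_Lfun1 (L2_mem f) (L2_mem g). Qed.

Lemma Lfun2P (f : R -> R) : measurable_fun setT f -> int01 (fun s => f s ^+ 2) ->
  f \in Lfun m01 2%:E.
Proof.
move=> mf if2; rewrite inE; apply/andP; split; rewrite inE//=.
rewrite /finite_norm unlock /Lnorm poweR_lty//.
under eq_integral => x _.
  rewrite /= powR_mulrn ?normr_ge0// real_normK ?num_real//.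
  over.
exact: integrable_lty.
Qed.

Lemma Lfun2_le (f g : R -> R) : measurable_fun setT f -> (forall s, `|f s| <= `|g s|) ->
  g \in Lfun m01 2%:E -> f \in Lfun m01 2%:E.
Proof.
move=> mf fg g2; apply: Lfun2P => //.
apply: le_integrable (Lfun2_integrable_sqr g2) => //.
  by apply/measurable_EFinP; exact: measurable_funX.
move=> x _ /=; rewrite lee_fin !normrX.
by rewrite lerXn2r ?nnegrE ?normr_ge0.
Qed.

Definition mkL2 (f : R -> R) (fP : f \in Lfun m01 2%:E) : L2 R :=
  Lfun_Sub (lee1n 2) fP.

Lemma L2_addE (f g : L2 R) s : (f + g) s = f s + g s. Proof. by []. Qed.
Lemma L2_oppE (f : L2 R) s : (- f) s = - f s. Proof. by []. Qed.
Lemma L2_subE (f g : L2 R) s : (f - g) s = f s - g s. Proof. by []. Qed.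
Lemma L2_scaleE (a : R) (f : L2 R) s : (a *: f) s = a * f s. Proof. by []. Qed.
Lemma L2innerDr (f g h : L2 R) : L2inner f (g + h) = L2inner f g + L2inner f h.
Proof.
rewrite /L2inner -RintegralD//; [|exact: L2_intM..].
by apply: eq_Rintegral => x _; rewrite L2_addE mulrDr.
Qed.

Lemma L2innerZr (f g : L2 R) a : L2inner f (a *: g) = a * L2inner f g.
Proof.
rewrite /L2inner -RintegralZl//; last exact: L2_intM.
by apply: eq_Rintegral => x _; rewrite L2_scaleE mulrCA.
Qed.

Lemma L2innerC (f g : L2 R) : L2inner f g = L2inner g f.
Proof. by apply: eq_Rintegral => x _; rewrite mulrC. Qed.

Lemma L2innerNr (f g : L2 R) : L2inner f (- g) = - L2inner f g.
Proof. by rewrite -scaleN1r L2innerZr mulN1r. Qed.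

Lemma L2innerBr (f g h : L2 R) : L2inner f (g - h) = L2inner f g - L2inner f h.
Proof. by rewrite L2innerDr L2innerNr. Qed.

Lemma L2norm_ge0 (f : L2 R) : 0 <= L2norm f.
Proof. by rewrite fine_ge0// Lnorm_ge0. Qed.

Lemma L2normZ (f : L2 R) a : L2norm (a *: f) = `|a| * L2norm f.
Proof.
by apply: EFin_inj; rewrite EFinM /L2norm !finite_norm_fine -LnormZ.
Qed.

Lemma L2normD (f g : L2 R) : L2norm (f + g) <= L2norm f + L2norm g.
Proof. exact: ler_LnormD. Qed.

Lemma L2normN (f : L2 R) : L2norm (- f) = L2norm f.
Proof. exact: LnormrN. Qed.

Lemma L2_CauchySchwarz (f g : L2 R) : `|L2inner f g| <= L2norm f * L2norm g.
Proof.
apply: le_trans (le_normr_Rintegral _ (L2_intM f g)) _ => //.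
rewrite -lee_fin EFinM /L2norm !finite_norm_fine.
have h2 : 2^-1 + 2^-1 = 1 :> R by rewrite [RHS]splitr !div1r.
have := @hoelder _ _ _ m01 (f : R -> R) (g : R -> R) 2 2
  (@L2_meas f) (@L2_meas g) (ltr0n _ 2) (ltr0n _ 2) h2.
rewrite Lnorm1; apply: le_trans.
rewrite /Rintegral fineK//.
by apply: integrable_fin_num => //; exact: (integrable_norm (L2_intM f g)).
Qed.

(** These two instances discharge the filter side conditions of [filterS] for
    the measures in use. *)
Global Instance ae01_filter : Filter (almost_everywhere m01) :=
  ae_filter_ringOfSetsType m01.

Global Instance ae_lebesgue_filter : Filter (almost_everywhere (@lebesgue_measure R)) :=
  ae_filter_ringOfSetsType (@lebesgue_measure R).

End L2basics.

(** * Integrals over the unit interval *)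

Section int01.
Context {R : realType}.
Notation m01 := (lebesgue01 R).
Notation int01 f := (m01.-integrable setT (EFin \o f)).
Implicit Types f g : R -> R.

Lemma ae01 (P : R -> Prop) : (forall s, 0 < s < 1 -> P s) -> {ae m01, forall s, P s}.
Proof.
move=> H; exists (~` `]0, 1[); split.
- by apply: measurableC; exact: measurable_itv.
- by rewrite lebesgue01E setICl measure0.
- by move=> s /= nP; rewrite in_itv/= => /H.
Qed.

Lemma int01_meas f : int01 f -> measurable_fun setT f.
Proof. by move=> /integrableP[/measurable_EFinP]. Qed.

Lemma int01_le f g : measurable_fun setT f -> int01 g ->
  {ae m01, forall s, `|f s| <= g s} -> int01 f.
Proof.
move=> mf ig fg; have mg := int01_meas ig.
apply/integrableP; split; first exact/measurable_EFinP.
have /integrableP[_ ig'] := ig; apply: le_lt_trans ig'.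
apply: ae_ge0_le_integral => //.
- by apply/measurable_EFinP; exact: measurableT_comp.
- by apply/measurable_EFinP; exact: measurableT_comp.
- apply: filterS fg => s fgs _ /=; rewrite lee_fin.
  exact: le_trans fgs (ler_norm _).
Qed.

Lemma int01_cst (c : R) : int01 (fun=> c).
Proof.
apply: measurable_bounded_integrable => //.
  by rewrite -ge0_fin_numE// lebesgue01T.
by exists `|c|; split; [exact: num_real|move=> M cM s _ /=; exact: ltW].
Qed.

Lemma int01D f g : int01 f -> int01 g -> int01 (fun s => f s + g s).
Proof. by move=> fi gi; exact: (integrableD _ fi gi). Qed.

Lemma int01B f g : int01 f -> int01 g -> int01 (fun s => f s - g s).
Proof. by move=> fi gi; exact: (integrableB _ fi gi). Qed.

Lemma int01Zl (c : R) f : int01 f -> int01 (fun s => c * f s).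
Proof. by move=> fi; exact: (integrableZl _ c fi). Qed.

Lemma int01_norm f : int01 f -> int01 (fun s => `|f s|).
Proof. exact: integrable_norm. Qed.

(** The weight [1 - 2 s] is bounded by 1 on the unit interval only; this is
    what the almost everywhere domination of [int01_le] is for. *)
Lemma int01_slope (f : R -> R) : int01 f -> int01 (fun s => (1 - 2 * s) * f s).
Proof.
move=> fi; apply: int01_le (int01_norm fi) _.
  apply: measurable_funM (int01_meas fi).
  by apply: measurable_funB => //; exact: measurable_funM.
apply: ae01 => s /andP[s0 s1]; rewrite normrM ler_piMl//.
by rewrite ler_norml; lra.
Qed.

Lemma Rint01_ge0 f : {ae m01, forall s, 0 <= f s} -> int01 f ->
  0 <= \int[m01]_s f s.
Proof.
move=> f0 fi; have mf := int01_meas fi.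
suff -> : \int[m01]_s f s = \int[m01]_s `|f s|.
  by apply: Rintegral_ge0 => s _; exact: normr_ge0.
congr fine; apply: ae_eq_integral => //; first exact/measurable_EFinP.
  by apply/measurable_EFinP; exact: measurableT_comp.
by apply: filterS f0 => s f0 _; rewrite ger0_norm.
Qed.

Lemma Rint01_le f g : int01 f -> int01 g -> {ae m01, forall s, f s <= g s} ->
  \int[m01]_s f s <= \int[m01]_s g s.
Proof.
move=> fi gi fg; rewrite -subr_ge0 -RintegralB//; apply: Rint01_ge0.
  by apply: filterS fg => s; rewrite subr_ge0.
exact: int01B.
Qed.

Lemma Rint01_eq0 f : int01 f -> {ae m01, forall s, 0 <= f s} ->
  \int[m01]_s f s <= 0 -> {ae m01, forall s, f s = 0}.
Proof.
move=> fi f0 fle; have mf := int01_meas fi.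
have : (\int[m01]_s `|(f s)%:E| = 0)%E.
  rewrite -[RHS](_ : (\int[m01]_s f s)%:E = 0%E); last first.
    by congr EFin; apply/eqP; rewrite eq_le fle Rint01_ge0.
  rewrite /Rintegral fineK; last exact: integrable_fin_num.
  apply: ae_eq_integral => //; last first.
  - by apply: filterS f0 => s f0 _ /=; rewrite ger0_norm.
  - exact/measurable_EFinP.
  - by apply/measurable_EFinP; exact: measurableT_comp.
have mfe : measurable_fun setT (EFin \o f) by exact/measurable_EFinP.
move/(ae_eq_integral_abs m01 measurableT mfe).
by apply: filterS => s /(_ I) [].
Qed.

End int01.

(** * Translations of the unit interval *)

Section shift.
Context {R : realType}.
Notation m01 := (lebesgue01 R).
Notation mu := (@lebesgue_measure R).
Notation int01 f := (m01.-integrable setT (EFin \o f)).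

Lemma measurable_translation (h : R) : measurable_fun [set: measurableTypeR R]
  ((fun s => s - h) : measurableTypeR R -> measurableTypeR R).
Proof. by apply: measurable_funB. Qed.

Lemma lebesgue_measure_shift (h : R) (A : set R) : measurable A ->
  pushforward mu ((fun s => s - h) : measurableTypeR R -> measurableTypeR R) A = mu A.
Proof.
have mh := measurable_translation h.
pose phi : {mfun measurableTypeR R >-> measurableTypeR R} :=
  HB.pack (fun s : measurableTypeR R => s - h : measurableTypeR R)
    (isMeasurableFun.Build _ _ _ _ _ mh).
move=> mA; rewrite -[LHS]/(pushforward mu phi A).
apply/esym/lebesgue_measure_unique => //= _ [[a b]] _ <-.
have -> : pushforward mu phi `]a, b] = mu `]a + h, b + h].
  congr mu; apply/seteqP; split => x /=; rewrite !in_itv/= => /andP[? ?]; lra.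
rewrite !lebesgue_measure_itv/= !lte_fin ltrD2r.
by case: ifPn => // _; rewrite -!EFinD opprD addrACA subrr addr0.
Qed.

Lemma integral_shift (h : R) (f : R -> \bar R) : measurable_fun setT f ->
  (forall x, 0 <= f x)%E ->
  (\int[mu]_x f (x - h)%R = \int[mu]_x f x)%E.
Proof.
move=> mf f0.
have mh := measurable_translation h.
rewrite -[LHS](@ge0_integral_pushforward _ _ (measurableTypeR R) (measurableTypeR R) R
  ((fun s => s - h) : measurableTypeR R -> measurableTypeR R) mh mu setT f)//.
by apply: eq_measure_integral => A mA _; exact: lebesgue_measure_shift.
Qed.

(** For functions that vanish outside the unit interval the restriction of the
    measure is immaterial, so that translation invariance becomes available. *)
Lemma integral01E (f : R -> \bar R) : (forall s, ~~ (0 < s < 1) -> f s = 0%E) ->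
  (\int[m01]_x f x = \int[mu]_x f x)%E.
Proof.
move=> f0.
have fE : f = f \_ `]0, 1[.
  apply/funext => x; rewrite patchE; case: ifPn => //.
  by rewrite notin_setE/= in_itv/= => /negP/f0.
rewrite fE -!integral_mkcond.
by apply: eq_measure_integral => A mA AD; rewrite /= /mrestr setIidl.
Qed.

Variable h : R.
(** Functions vanishing off the window can be translated by [h] without
    leaving the unit interval. *)
Definition window (s : R) : bool := (0 < s < 1) && (0 < s + h < 1).

Lemma integral01_shift (f : R -> R) : measurable_fun setT f ->
  (forall s, ~~ window s -> f s = 0) ->
  (\int[m01]_s (f (s - h)%R)%:E = \int[m01]_s (f s)%:E)%E.
Proof.
have key (g : R -> \bar R) : measurable_fun setT g -> (forall x, 0 <= g x)%E ->
    (forall s, ~~ window s -> g s = 0%E) ->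
    (\int[m01]_s g (s - h)%R = \int[m01]_s g s)%E.
  move=> mg g0 gw; rewrite !integral01E; first exact: integral_shift.
  - by move=> s s01; apply: gw; rewrite negb_and s01.
  - by move=> s s01; apply: gw; rewrite negb_and subrK s01 orbT.
move=> mf fw; rewrite integralE [RHS]integralE.
have mfe : measurable_fun setT (EFin \o f) by exact/measurable_EFinP.
congr (_ - _)%E.
- rewrite -(key (fun s => (EFin \o f)^\+ s)%E).
  + by apply: eq_integral => s _; rewrite !funeposE.
  + exact: measurable_funepos.
  + by move=> s; exact: funepos_ge0.
  + by move=> s /fw fs; rewrite funeposE /= fs maxxx.
- rewrite -(key (fun s => (EFin \o f)^\- s)%E).
  + by apply: eq_integral => s _; rewrite !funenegE.
  + exact: measurable_funeneg.
  + by move=> s; exact: funeneg_ge0.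
  + by move=> s /fw fs; rewrite funenegE /= fs oppr0 maxxx.
Qed.

Lemma measurable_shift (f : R -> R) : measurable_fun setT f ->
  measurable_fun setT (fun s : R => f (s - h)).
Proof. by move=> mf; apply: measurableT_comp => //; exact: measurable_funB. Qed.

Lemma measurable_shiftr (f : R -> R) : measurable_fun setT f ->
  measurable_fun setT (fun s : R => f (s + h)).
Proof. by move=> mf; apply: measurableT_comp => //; exact: measurable_funD. Qed.

Lemma int01_shift (f : R -> R) : measurable_fun setT f ->
  (forall s, ~~ window s -> f s = 0) ->
  int01 f <-> int01 (fun s => f (s - h)).
Proof.
move=> mf fw.
have E : (\int[m01]_s `|(f (s - h)%R)%:E| = \int[m01]_s `|(f s)%:E|)%E.
  rewrite -[LHS]/(\int[m01]_s ((fun x => `|f x|%R) (s - h)%R)%:E)%E integral01_shift//.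
    exact: measurableT_comp.
  by move=> s /fw /= ->; rewrite normr0.
split => /integrableP[_ fi]; apply/integrableP; split.
- by apply/measurable_EFinP; exact: measurable_shift.
- by rewrite /= E.
- exact/measurable_EFinP.
- by move: fi; rewrite /= E.
Qed.

Lemma Rint01_shift (f : R -> R) : measurable_fun setT f ->
  (forall s, ~~ window s -> f s = 0) ->
  \int[m01]_s f (s - h) = \int[m01]_s f s.
Proof. by move=> mf fw; rewrite /Rintegral integral01_shift. Qed.

End shift.

Section shiftL2.
Context {R : realType}.
Notation m01 := (lebesgue01 R).
Notation int01 f := (m01.-integrable setT (EFin \o f)).
Variables (h : R) (p : L2 R).
Hypothesis pw : forall s, ~~ window h s -> p s = 0.

Lemma shift_Lfun : (fun s : R => p (s - h)) \in Lfun m01 2%:E.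
Proof.
apply: Lfun2P; first exact: measurable_shift (@L2_meas _ p).
apply: (int01_shift (f := fun s => p s ^+ 2) _ _).1.
- by apply: measurable_funX; exact: L2_meas.
- by move=> s /pw ->; rewrite expr0n.
- exact: Lfun2_integrable_sqr (L2_mem p).
Qed.

Definition shiftL2 : L2 R := mkL2 shift_Lfun.

Lemma shiftL2E s : shiftL2 s = p (s - h). Proof. by []. Qed.

Lemma L2inner_shift (v : L2 R) :
  L2inner shiftL2 v = \int[m01]_s (p s * v (s + h)).
Proof.
rewrite -[RHS](@Rint01_shift _ h).
- by apply: eq_Rintegral => s _; rewrite shiftL2E subrK.
- apply: measurable_funM; first exact: L2_meas.
  exact: measurable_shiftr (@L2_meas _ v).
- by move=> s /pw ->; rewrite mul0r.
Qed.

Lemma int01_shiftM (v : L2 R) : int01 (fun s : R => p s * v (s + h)).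
Proof.
apply: (int01_shift (h := h) _ _).2.
- apply: measurable_funM; first exact: L2_meas.
  exact: measurable_shiftr (@L2_meas _ v).
- by move=> s /pw ->; rewrite mul0r.
- have := L2_intM shiftL2 v; congr (m01.-integrable setT).
  by apply/funext => s /=; rewrite subrK.
Qed.

End shiftL2.

(** * Quantile functions *)

Section quantile.
Context {R : realType}.
Variable nu : probability (measurableTypeR R) R.

Lemma Rplus_homo x y : x <= y -> (Rplus nu x <= Rplus nu y)%E.
Proof.
move=> xy; apply: le_measure; rewrite ?inE//.
by apply: subset_itvl; rewrite bnd_simp.
Qed.

Let idR : measurableTypeR R -> R := idfun.
Let midR : measurable_fun setT idR. Proof. exact: measurable_id. Qed.
#[local] HB.instance Definition _ := @isMeasurableFun.Build _ _ _ _ idR midR.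

Lemma Rplus_ge (s : R) : s < 1 -> exists x, (s%:E <= Rplus nu x)%E.
Proof.
move=> s1; have c1 := @cvg_cdfy1 _ _ _ nu (idR : {RV nu >-> R}).
have H : nbhs (1%E : \bar R) (fun u => s%:E < u)%E.
  by apply: open_ereal_gt'; rewrite lte_fin.
have {H}/filter_ex[x /= sx] : \forall x \near +oo%R, (s%:E < cdf idR x)%E := c1 _ H.
by exists x; apply: ltW.
Qed.

Lemma Rplus_lt (s : R) : 0 < s -> exists x, (Rplus nu x < s%:E)%E.
Proof.
move=> s0; have c0 := @cvg_cdfNy0 _ _ _ nu (idR : {RV nu >-> R}).
have H : nbhs (0%E : \bar R) (fun u => u < s%:E)%E.
  by apply: open_ereal_lt'; rewrite lte_fin.
have {H}/filter_ex[x /= sx] : \forall x \near -oo%R, (cdf idR x < s%:E)%E := c0 _ H.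
by exists x.
Qed.

(** A distribution function tends to 0 and 1 at infinity, so the set defining
    a quantile is nonempty and bounded below. *)
Lemma quantile_has_inf (s : R) : 0 < s < 1 ->
  has_inf [set x | (s%:E <= Rplus nu x)%E].
Proof.
move=> /andP[s0 s1]; split; first exact: Rplus_ge.
have [x xs] := Rplus_lt s0; exists x => y /= sy.
rewrite leNgt; apply/negP => yx.
by have := lt_le_trans xs sy; rewrite ltNge (Rplus_homo (ltW yx)).
Qed.

Lemma quantile_homo : {in `]0, 1[ &, {homo quantile nu : x y / x <= y}}.
Proof.
move=> x y; rewrite !in_itv/= => x01 y01 xy.
apply: lb_le_inf; first by case: (quantile_has_inf y01).
move=> z /= yz; apply: ge_inf; first by case: (quantile_has_inf x01).
by rewrite /=; apply: le_trans yz; rewrite lee_fin.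
Qed.

(** Superlevel sets of a monotone function on an interval are intervals. *)
Lemma homo_measurable (D : interval R) (f : R -> R) :
  {in D &, {homo f : x y / x <= y}} -> measurable_fun [set` D] f.
Proof.
move=> fD mD; apply: (measurability (@RGenCInfty.G R)) mD => [|/= _ [_] [r] -> <-].
  exact: RGenCInfty.measurableE.
apply: is_interval_measurable => s t /= [Ds +] [Dt +] u sut.
rewrite !in_itv/= !andbT => fs ft.
have Du : [set` D] u by apply: (@interval_is_interval _ D s t).
split; first by move: Du => /=; rewrite in_itv.
by rewrite /= (le_trans fs)// fD//; case/andP: sut.
Qed.

Let q : R -> R := quantile nu \_ `]0, 1[.

Lemma measurable_qrestr : measurable_fun setT q.
Proof.
apply/(measurable_restrictT _ _).1 => //; exact: (homo_measurable quantile_homo).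
Qed.

(** Here the set defining the quantile is everything or empty, and its infimum
    is the default value 0. *)
Lemma quantile_out (t : R) : t <= 0 \/ 1 < t -> quantile nu t = 0.
Proof.
case=> t01; apply: inf_out => -[].
- move=> _ [x /= xlb].
  have : x <= x - 1.
    by apply: xlb => /=; apply: (@le_trans _ _ 0%E); rewrite ?lee_fin.
  by rewrite leNgt => /negP; apply; rewrite ltrBlDr ltrDl.
- move=> [x /= tx] _; have := le_trans tx (probability_le1 nu (measurable_itv _)).
  by rewrite lee_fin leNgt t01.
Qed.

(** The value at 1 depends on whether nu has an upper bound; it is split off
    as a multiple of an indicator. *)
Lemma measurable_quantile : measurable_fun setT (quantile nu).
Proof.
rewrite (_ : quantile nu = fun t => q t + quantile nu 1 * \1_[set 1] t); last first.
  apply/funext => t; rewrite /q patchE indicE.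
  case: ifPn; rewrite ?inE ?notin_setE/= in_itv/=.
    move=> /andP[t0 t1]; rewrite memNset ?mulr0 ?addr0//= => t1E.
    by rewrite t1E ltxx in t1.
  move=> t01; have [->|tn1] := eqVneq t 1.
    by rewrite mem_set// mulr1 add0r.
  rewrite memNset; last exact/eqP.
  rewrite mulr0 addr0 quantile_out//.
  move/negP: t01; rewrite negb_and -!leNgt => /orP[t0|t1]; first by left.
  by right; rewrite lt_neqAle eq_sym tn1.
apply: measurable_funD; first exact: measurable_qrestr.
by apply: measurable_funM => //; exact: measurable_indic.
Qed.

End quantile.

(** * The energy and its subgradients *)

Section energy.
Context {R : realType}.
Variable nu : probability (measurableTypeR R) R.
Notation m01 := (lebesgue01 R).
Notation int01 f := (m01.-integrable setT (EFin \o f)).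
Notation Q := (quantile nu).

(** The mean distance from [x] to nu, written with the quantile function of
    nu. *)
Definition interaction (x : R) : R := \int[m01]_t `|x - Q t|.
Notation E := interaction.

Lemma measurable_interaction_kernel x : measurable_fun setT (fun t => x - Q t).
Proof. by apply: measurable_funB => //; exact: measurable_quantile. Qed.

(** Changing [x] changes the integrand by a bounded amount. Hence the integral
    converges for every [x] or diverges for every [x], and in the second case
    it has the default value 0. The estimates below hold in both cases. *)
Lemma interaction_dichotomy :
  (forall x, int01 (fun t => `|x - Q t|)) \/ (forall x, E x = 0).
Proof.
have [iQ|niQ] := pselect (int01 (quantile nu)); [left => x|right => x].
  by apply: int01_norm; apply: int01B => //; exact: int01_cst.
suff : (\int[m01]_t `|x - Q t|%:E = +oo)%E by rewrite /E /Rintegral => ->.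
apply: contra_notP niQ => /eqP; rewrite -ltey => xfin.
have ix : int01 (fun t => x - Q t).
  apply/integrableP; split; last exact: xfin.
  by apply/measurable_EFinP; exact: measurable_interaction_kernel.
rewrite (_ : Q = fun t => x - (x - Q t)); last by apply/funext => t; ring.
by apply: int01B => //; exact: int01_cst.
Qed.

Lemma interaction_lip x y : E x - E y <= `|x - y|.
Proof.
case: interaction_dichotomy => [iE|E0]; last by rewrite !E0 subrr.
rewrite /E -RintegralB//.
have -> : `|x - y| = \int[m01]_t `|x - y|.
  by rewrite Rintegral_cst// lebesgue01T mulr1.
apply: le_Rintegral => //; first exact: int01B.
  exact: int01_cst.
move=> t _; rewrite lerBlDr (le_trans _ (ler_normD _ _))//.
by rewrite le_eqVlt (_ : x - y + (y - Q t) = x - Q t) ?eqxx//; ring.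
Qed.

Lemma interaction_dist x y : `|E x - E y| <= `|x - y|.
Proof.
rewrite ler_norml interaction_lip andbT lerNl opprB distrC.
exact: interaction_lip.
Qed.

(** Moving two points towards each other by the same amount does not increase
    a convex function. This is the only way in which convexity enters the
    proof. *)
Lemma interaction_transfer a b d : 0 <= d -> d <= b - a ->
  E (a + d) + E (b - d) <= E a + E b.
Proof.
move=> d0 dab; case: interaction_dichotomy => [iE|E0]; last by rewrite !E0 !addr0.
rewrite /E -!RintegralD//; apply: le_Rintegral => //.
- exact: int01D.
- exact: int01D.
move=> t _; move: (Q t) => q.
by case: (ler0P (a - q)); case: (ler0P (b - q)); case: (ler0P (a + d - q));
  case: (ler0P (b - d - q)); lra.
Qed.

Lemma interaction_continuous : continuous E.
Proof.
move=> x; apply/cvgrPdist_le => /= e e0; apply/nbhs_ballP; exists e => //= y xy.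
by rewrite (le_trans (interaction_dist _ _))// ltW.
Qed.

Lemma measurable_interaction_comp (f : R -> R) : measurable_fun setT f ->
  measurable_fun setT (fun s => E (f s)).
Proof.
move=> mf; apply: measurableT_comp mf.
exact: continuous_measurable_fun interaction_continuous.
Qed.

Lemma int01_interaction (f : R -> R) : int01 f -> int01 (fun s => E (f s)).
Proof.
move=> fi; apply: (@int01_le _ _ (fun s => `|f s| + `|E 0|)).
- exact: measurable_interaction_comp (int01_meas fi).
- by apply: int01D (int01_norm fi) _; exact: int01_cst.
- apply: nearW => s; have := interaction_dist (f s) 0; rewrite subr0.
  rewrite -lerBlDr; apply: le_trans; rewrite lerBlDr.
  by rewrite (le_trans _ (ler_normD _ _))// subrK.
Qed.

Lemma F_addB (u w : L2 R) : F_ nu (u + w) - F_ nu u =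
  \int[m01]_s ((1 - 2 * s) * w s + (E (u s + w s) - E (u s))).
Proof.
have H (f : L2 R) : int01 (fun s => (1 - 2 * s) * f s + E (f s)).
  by apply: int01D (int01_slope (L2_int f)) (int01_interaction (L2_int f)).
rewrite /F_ -(RintegralB _ (H (u + w)) (H u))//.
by apply: eq_Rintegral => s _; rewrite /E L2_addE; ring.
Qed.

Lemma int01_F_addB (u w : L2 R) :
  int01 (fun s => (1 - 2 * s) * w s + (E (u s + w s) - E (u s))).
Proof.
apply: int01D (int01_slope (L2_int w)) _.
by apply: int01B; apply: int01_interaction; [exact: L2_int (u + w)|exact: L2_int].
Qed.

(** A subgradient tested along a fixed direction [w]. The error term is
    rescaled so that it does not involve the norm of [w]. *)
Lemma subdifferential_dir (u v w : L2 R) : subdifferential (F_ nu) u (- v) ->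
  forall e, 0 < e -> exists2 a0, 0 < a0 & forall a, 0 < a < a0 ->
  - (a * L2inner v w) - a * e <=
  \int[m01]_s ((1 - 2 * s) * (a * w s) + (E (u s + a * w s) - E (u s))).
Proof.
move=> sub e e0; have w1 : 0 < L2norm w + 1 by rewrite ltr_wpDl// L2norm_ge0.
have [d d0 dP] := sub (e / (L2norm w + 1)) (divr_gt0 e0 w1).
exists (d / (L2norm w + 1)); first exact: divr_gt0.
move=> a /andP[a0 aw].
have := dP (u + a *: w); rewrite [u + _ - u]addrAC subrr add0r.
have aE : `|a| = a by rewrite gtr0_norm.
rewrite L2normZ aE => /(_ _)/wrap[].
  apply: le_lt_trans (_ : a * (L2norm w + 1) < d); last by rewrite -ltr_pdivlMr.
  by rewrite ler_pM2l// lerDl.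
rewrite -(F_addB u (a *: w)) L2innerC L2innerNr L2innerC L2innerZr => H.
have : e / (L2norm w + 1) * (a * L2norm w) <= a * e.
  rewrite mulrCA ler_pM2l// mulrAC ler_pdivrMr// ler_pM2l//.
  by rewrite lerDl.
move: H; move: (F_ nu u) (F_ nu _) (a * L2inner v w) (a * e) (_ * (a * L2norm w)).
by move=> A B x y z; lra.
Qed.

End energy.

Section subdiff.
Context {R : realType}.
Variable nu : probability (measurableTypeR R) R.
Notation m01 := (lebesgue01 R).
Notation int01 f := (m01.-integrable setT (EFin \o f)).
Notation E := (interaction nu).

(** The interaction is 1-Lipschitz, so that moving along [- phi] raises the
    energy at most at the rate on the right-hand side. For [phi] of constant
    sign this locates [v s] between [- 2 (1 - s)] and [2 s]. *)
Lemma subdifferential_bound (u v phi : L2 R) : subdifferential (F_ nu) u (- v) ->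
  L2inner phi v <= \int[m01]_s (`|phi s| - (1 - 2 * s) * phi s).
Proof.
move=> sub.
have iR : int01 (fun s : R => `|phi s| - (1 - 2 * s) * phi s).
  by apply: int01B (int01_norm (L2_int phi)) (int01_slope (L2_int phi)).
apply/ler_addgt0Pr => e e0.
have [a0 a00 /(_ (a0 / 2))H] := subdifferential_dir (- phi) sub e0.
have a20 : 0 < a0 / 2 by rewrite divr_gt0.
have /H{H}H : 0 < a0 / 2 < a0 by lra.
set a := a0 / 2 in a20 H *.
have : \int[m01]_s ((1 - 2 * s) * (a * (- phi) s) +
    (E (u s + a * (- phi) s) - E (u s))) <=
    a * \int[m01]_s (`|phi s| - (1 - 2 * s) * phi s).
  rewrite -RintegralZl//; apply: le_Rintegral => //.
  - exact: (int01_F_addB nu u (a *: - phi)).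
  - exact: int01Zl.
  move=> s _; rewrite L2_oppE.
  have := interaction_lip nu (u s + a * - phi s) (u s).
  rewrite addrAC subrr add0r normrM normrN gtr0_norm// mulrBr => Hl.
  have -> : (1 - 2 * s) * (a * - phi s) = - (a * ((1 - 2 * s) * phi s)) by ring.
  lra.
move/(le_trans H); rewrite L2innerNr (L2innerC v) => {}H.
by rewrite -(ler_pM2l a20); lra.
Qed.

(** Comparison of the velocities at the levels [s] and [s + h]. Raising [u] by
    [a p] at [s] and lowering it by [a p] at [s + h] brings the two values
    closer, so by convexity the interaction does not increase. Only the linear
    part of the energy is left; its slopes at the two levels differ by [2 h]. *)
Lemma subdifferential_shift (h : R) (u v p : L2 R)
  (pw : forall s, ~~ window h s -> p s = 0) : subdifferential (F_ nu) u (- v) ->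
  (forall s : R, 0 <= p s) -> (forall s : R, p s != 0 -> p s <= u (s + h) - u s) ->
  L2inner (shiftL2 pw - p) v <= 2 * h * \int[m01]_s p s.
Proof.
move=> sub p0 pu; apply/ler_addgt0Pr => e e0.
have e20 : 0 < e / 2 by rewrite divr_gt0.
have [a1 a10 H1] := subdifferential_dir p sub e20.
have [a2 a20 H2] := subdifferential_dir (- shiftL2 pw) sub e20.
(* One step size for both directions; at most 1, so that the amount moved
   stays below the gap between the two values. *)
pose a := Num.min 1 (Num.min (a1 / 2) (a2 / 2)).
have a0 : 0 < a by rewrite !lt_min ltr01 !divr_gt0.
have a_1 : a <= 1 by rewrite ge_min lexx.
have aa1 : a < a1.
  have : a <= a1 / 2 by rewrite !ge_min lexx orbT.
  lra.
have aa2 : a < a2.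
  have : a <= a2 / 2 by rewrite !ge_min lexx !orbT.
  lra.
have /H1{}H1 : 0 < a < a1 by rewrite a0.
have /H2{}H2 : 0 < a < a2 by rewrite a0.
(* The variation of the energy along the translate of [p], moved back by
   [h]. *)
pose G s := (1 - 2 * (s + h)) * (a * - p s) + (E (u (s + h) + a * - p s) - E (u (s + h))).
have Gw s : ~~ window h s -> G s = 0.
  by move=> /pw ps; rewrite /G ps oppr0 !mulr0 addr0 subrr add0r.
have mu' : measurable_fun setT (fun s : R => u (s + h)).
  exact: measurable_shiftr (@L2_meas _ u).
have mp : measurable_fun setT (fun s : R => a * - p s).
  by apply: measurable_funM => //; apply: measurable_funN; exact: L2_meas.
have mG : measurable_fun setT G.
  apply: measurable_funD.
    apply: measurable_funM => //; apply: measurable_funB => //.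
    by apply: measurable_funM => //; exact: measurable_funD.
  apply: measurable_funB; apply: measurable_interaction_comp => //.
  exact: measurable_funD.
have GE s : (1 - 2 * s) * (a * (- shiftL2 pw) s) +
    (E (u s + a * (- shiftL2 pw) s) - E (u s)) = G (s - h).
  by rewrite /G !subrK L2_oppE shiftL2E.
have iG : int01 G.
  apply: (int01_shift mG Gw).2.
  have := int01_F_addB nu u (a *: - shiftL2 pw).
  by congr (m01.-integrable setT); apply/funext => s; exact: congr1 (GE s).
move: H2; have -> : \int[m01]_s ((1 - 2 * s) * (a * (- shiftL2 pw) s) +
    (E (u s + a * (- shiftL2 pw) s) - E (u s))) = \int[m01]_s G s.
  rewrite -(Rint01_shift mG Gw).
  by apply: eq_Rintegral => s _; exact: GE.
move=> H2.
have i1 := int01_F_addB nu u (a *: p).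
have : \int[m01]_s ((1 - 2 * s) * (a * p s) + (E (u s + a * p s) - E (u s)))
    + \int[m01]_s G s <= 2 * h * a * \int[m01]_s p s.
  rewrite -RintegralD// -RintegralZl//; last exact: L2_int.
  apply: le_Rintegral => //.
  - exact: int01D.
  - by apply: int01Zl; exact: L2_int.
  move=> s _; rewrite /G.
  have [ps0|ps0] := eqVneq (p s) 0.
    by rewrite ps0 oppr0 !mulr0 !addr0 !subrr addr0.
  have ap : a * p s <= p s by rewrite ler_piMl.
  have := interaction_transfer nu (mulr_ge0 (ltW a0) (p0 s)) (le_trans ap (pu _ ps0)).
  rewrite mulrN.
  have -> : (1 - 2 * s) * (a * p s) = a * p s - 2 * (s * (a * p s)) by ring.
  have -> : (1 - 2 * (s + h)) * (- (a * p s)) =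
    - (a * p s) + 2 * (s * (a * p s)) + 2 * h * a * p s by ring.
  move: (E (u s + a * p s)) (E (u (s + h) - a * p s)) (E (u s)) (E (u (s + h))).
  move: (2 * h * a * p s) (s * (a * p s)) (a * p s).
  by clear; move=> b c d A B A' B'; lra.
move/(le_trans (lerD H1 H2)); rewrite L2innerNr (L2innerC (shiftL2 pw - p)) L2innerBr.
rewrite (mulrAC _ a) => H; rewrite -(ler_pM2l a0).
have -> : a * (2 * h * \int[m01]_s p s + e) = 2 * h * \int[m01]_s p s * a + a * e by ring.
move: H; rewrite mulrN mulrBr.
move: (a * L2inner v p) (a * L2inner v (shiftL2 pw)) (2 * h * _ * a).
by clear -e0; move=> A B c; lra.
Qed.

End subdiff.

(** * A smooth step function *)

Section smooth_step.
Context {R : realType}.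
Implicit Types (p : {poly R}) (f g : R -> R).

(** For [p = 1] this is the classical smooth function that vanishes to
    infinite order at 0. With a polynomial factor the family is closed under
    derivation. *)
Definition flat p (x : R) : R := if 0 < x then p.[x^-1] * expR (- x^-1) else 0.

(** Exponentials dominate polynomials; half of the exponent pays for each
    additional factor [y]. *)
Lemma poly_le_expR p e : 0 < e ->
  exists2 C, 0 <= C & forall y, 0 <= y -> `|p.[y]| <= C * expR (e * y).
Proof.
elim/poly_ind: p e => [|p c IH] e e0.
  by exists 0 => // y _; rewrite horner0 normr0 mul0r.
have e20 : 0 < e / 2 by rewrite divr_gt0.
have [C C0 HC] := IH _ e20.
exists (C * (e / 2)^-1 + `|c|); first by rewrite addr_ge0// mulr_ge0// invr_ge0 ltW.
move=> y y0; rewrite !hornerE (le_trans (ler_normD _ _))// mulrDl lerD//; last first.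
  by rewrite ler_peMr// -expR0 ler_expR mulr_ge0// ltW.
rewrite normrM (ger0_norm y0).
have -> : expR (e * y) = expR (e / 2 * y) * expR (e / 2 * y).
  by rewrite -expRD -mulrDl -splitr.
have yE : y <= (e / 2)^-1 * expR (e / 2 * y).
  rewrite mulrC ler_pdivlMr// mulrC (le_trans _ (expR_ge1Dx _))//.
  by rewrite lerDr.
apply: le_trans (ler_pM (normr_ge0 _) y0 (HC y y0) yE) _.
by rewrite mulrACA.
Qed.

Lemma flat_le p : exists2 C, 0 <= C & forall x, `|flat p x| <= C * `|x|.
Proof.
have h20 : 0 < 2^-1 :> R by rewrite invr_gt0.
have [C C0 HC] := poly_le_expR p h20.
exists (C * 2); first by rewrite mulr_ge0.
move=> x; rewrite /flat; case: ifPn => x0; last by rewrite normr0 !mulr_ge0.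
have xi0 : 0 < x^-1 by rewrite invr_gt0.
rewrite normrM (gtr0_norm (expR_gt0 _)) (gtr0_norm x0).
apply: le_trans (ler_wpM2r (expR_ge0 _) (HC _ (ltW xi0))) _.
rewrite -!mulrA -expRD ler_wpM2l//.
rewrite (_ : _ + _ = - (2^-1 * x^-1)); last by field; rewrite gt_eqF.
rewrite expRN -[leRHS]invrK lef_pV2 ?posrE ?expR_gt0 ?invr_gt0 ?mulr_gt0//.
rewrite invfM (le_trans _ (expR_ge1Dx _))//.
by rewrite lerDr.
Qed.

(** At 0 the difference quotient of [flat p] is [flat (p * 'X)], which tends
    to 0 by [flat_le]. *)
Lemma is_derive_flat p (x : R) :
  is_derive x 1 (flat p) (flat ('X^2 * (p - p^`())) x).
Proof.
have [x0|x0|->] := ltgtP x 0.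
- rewrite [X in is_derive _ _ _ X]/flat ltNge (ltW x0)/=.
  apply: (@near_eq_is_derive _ _ _ (cst 0)).
  near=> y; rewrite /flat ltNge ltW//.
  by near: y; exact: lt_nbhsl.
- apply: (@near_eq_is_derive R R^o R^o (fun y : R => p.[y^-1] * expR (- y^-1))).
    near=> y; rewrite /flat ifT//.
    by near: y; exact: lt_nbhsr.
  have x0' : x != 0 by rewrite gt_eqF.
  have di : is_derive x 1 (fun y : R => y^-1) (- x ^- 2).
    by have := @is_deriveV _ id x 1 1 x0' (is_derive_id _ _); rewrite /GRing.scale/= mulr1.
  have dp := @is_derive1_comp _ (horner p) (fun y : R => y^-1) x _ _ (is_derive_poly p _) di.
  have de := @is_derive1_comp _ expR (fun y : R => - y^-1) x _ _ (is_derive_expR _) (is_deriveN di).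
  have := is_deriveM dp de => /is_derive_eq; apply.
  transitivity (p.[x^-1] * (expR (- x^-1) * - - x ^- 2) +
    expR (- x^-1) * (p^`().[x^-1] * - x ^- 2)); first by [].
  rewrite /flat x0; have -> : ('X^2 * (p - p^`())).[x^-1] =
    x^-1 ^+ 2 * (p.[x^-1] - p^`().[x^-1]) by rewrite !hornerE.
  by rewrite -exprVn; ring.
- have [C C0 HC] := flat_le (p * 'X).
  have cv : (fun h => h^-1 *: (flat p (h *: 1 + 0) - flat p 0)) @ 0^' --> (0 : R).
    apply/cvgrPdist_le => /= e e0; near=> h.
    have hn0 : h != 0 by near: h; exact: nbhs_dnbhs_neq.
    rewrite sub0r normrN {2}/flat ltxx subr0 addr0 /GRing.scale/= mulr1.
    have -> : h^-1 * flat p h = flat (p * 'X) h.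
      rewrite /flat; case: ifPn => _; last by rewrite mulr0.
      by rewrite hornerMX; ring.
    rewrite (le_trans (HC h))//.
    apply: (@le_trans _ _ ((C + 1) * `|h|)).
      by rewrite ler_wpM2r// lerDl.
    rewrite -ler_pdivlMl ?ltr_wpDl//.
    near: h; apply: dnbhs0_le; rewrite mulr_gt0// invr_gt0 ltr_wpDl//.
  rewrite [X in is_derive _ _ _ X]/flat ltxx.
  by apply: DeriveDef; [apply/cvg_ex; exists 0|exact: cvg_lim cv].
Unshelve. all: by end_near. Qed.

(** A class of functions closed under derivation, so that all derivatives
    exist by induction on the order, and rich enough to contain a step
    function. *)
Inductive smooth_expr : (R -> R) -> Prop :=
| smooth_flat p a b : smooth_expr (fun x => flat p (a * x + b))
| smooth_cst c : smooth_expr (fun=> c)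
| smooth_add f g : smooth_expr f -> smooth_expr g -> smooth_expr (fun x => f x + g x)
| smooth_mul f g : smooth_expr f -> smooth_expr g -> smooth_expr (fun x => f x * g x)
| smooth_inv f : smooth_expr f -> (forall x, 0 < f x) -> smooth_expr (fun x => (f x)^-1).

Lemma smooth_expr_is_derive f : smooth_expr f ->
  exists2 g, smooth_expr g & forall x : R, is_derive x 1 f (g x).
Proof.
elim=> {f} [p a b|c|f g _ [f' sf df] _ [g' sg dg]|f g sf0 [f' sf df] sg0 [g' sg dg]|f sf0 [f' sf df] f0].
- exists (fun x => a * flat ('X^2 * (p - p^`())) (a * x + b)).
    by apply: smooth_mul; [exact: smooth_cst|exact: smooth_flat].
  move=> x; rewrite mulrC.
  apply: (@is_derive1_comp _ (flat p) (fun y => a * y + b)).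
    exact: is_derive_flat.
  have := is_deriveD (is_deriveZ a (@is_derive_id R R^o x 1)) (@is_derive_cst R R^o R^o b x 1).
  by move/is_derive_eq; apply; rewrite addr0 /GRing.scale/= mulr1.
- by exists (fun=> 0); [exact: smooth_cst|move=> x; exact: is_derive_cst].
- by exists (fun x => f' x + g' x); [exact: smooth_add|move=> x; exact: is_deriveD].
- exists (fun x => f x * g' x + g x * f' x).
    by apply: smooth_add; apply: smooth_mul.
  by move=> x; have := is_deriveM (df x) (dg x).
- exists (fun x => (-1) * ((f x)^-1 * (f x)^-1) * f' x).
    by apply: smooth_mul => //; apply: smooth_mul; [exact: smooth_cst|apply: smooth_mul; exact: smooth_inv].
  move=> x; have := is_deriveV (lt0r_neq0 (f0 x)) (df x).
  move/is_derive_eq; apply.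
  by rewrite /GRing.scale/= mulN1r -expr2 exprVn.
Qed.

Lemma smooth_expr_shift f c : smooth_expr f -> smooth_expr (fun x => f (x - c)).
Proof.
elim=> {f} [p a b|k|f g _ sf _ sg|f g _ sf _ sg|f _ sf f0].
- rewrite (_ : (fun x => _) = fun x => flat p (a * x + (b - a * c))); first exact: smooth_flat.
  by apply/funext => x; congr flat; ring.
- exact: smooth_cst.
- exact: smooth_add.
- exact: smooth_mul.
- by apply: smooth_inv.
Qed.

Lemma smooth_expr_derive1 f : smooth_expr f -> smooth_expr (derive1 f).
Proof.
move=> /smooth_expr_is_derive[g sg dg]; suff -> : derive1 f = g by [].
by apply/funext => x; rewrite derive1E; exact: derive_val.
Qed.

Lemma smooth_expr_derivable f n x : smooth_expr f -> derivable (derive1n n f) x 1.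
Proof.
move=> sf; have : smooth_expr (derive1n n f).
  by elim: n => // n IH; rewrite derive1nS; exact: smooth_expr_derive1.
by move=> /smooth_expr_is_derive[g _ dg]; apply: ex_derive; exact: dg.
Qed.

Lemma smooth_expr_continuous f : smooth_expr f -> continuous f.
Proof.
move=> /(@smooth_expr_derivable _ 0) df x.
by apply: differentiable_continuous; apply/derivable1_diffP; exact: df.
Qed.

Lemma is_derive_nondecreasing_ge0 f (x d : R) :
  {homo f : x y / x <= y} -> is_derive x 1 f d -> 0 <= d.
Proof.
move=> fh [df <-]; rewrite /derive.
apply: limr_ge; first exact: df.
near=> h; rewrite /GRing.scale/= mulr1.
have [h0|h0] := leP 0 h.
  by rewrite mulr_ge0 ?invr_ge0// subr_ge0 fh// lerDr.
by rewrite mulr_le0 ?invr_le0 ?(ltW h0)// subr_le0 fh// gerDr ltW.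
Unshelve. all: by end_near. Qed.

(** The quotient [e x / (e x + e (d - x))] with [e] the flat function; its
    denominator never vanishes because [x] or [d - x] is positive. *)
Lemma smooth_step (d : R) : 0 < d -> exists P : R -> R, [/\ smooth_expr P,
  {homo P : x y / x <= y}, forall x, x <= 0 -> P x = 0 & forall x, d <= x -> P x = 1].
Proof.
move=> d0; pose e := flat 1.
have e_0 x : x <= 0 -> e x = 0 by move=> x0; rewrite /e /flat ltNge x0.
have e_gt0 x : 0 < x -> 0 < e x.
  by move=> x0; rewrite /e /flat x0 hornerC mul1r expR_gt0.
have e_ge0 x : 0 <= e x.
  by have [/e_0->//|/e_gt0/ltW] := leP x 0.
have eh x y : x <= y -> e x <= e y.
  move=> xy; have [/e_0->//|x0] := leP x 0.
  have y0 := lt_le_trans x0 xy.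
  by rewrite /e /flat x0 y0 !hornerC !mul1r ler_expR lerN2 lef_pV2.
have den x : 0 < e x + e (d - x).
  have [x0|x0] := leP x 0; last by rewrite ltr_pwDl// e_gt0.
  by rewrite ltr_wpDl// e_gt0//; lra.
exists (fun x => e x * (e x + e (d - x))^-1); split.
- have se : smooth_expr e.
    rewrite (_ : e = fun x => e (1 * x + 0)); first exact: smooth_flat.
    by apply/funext => x; rewrite mul1r addr0.
  apply: smooth_mul => //; apply: smooth_inv => //; apply: smooth_add => //.
  rewrite (_ : (fun x => _) = fun x => e ((-1) * x + d)); first exact: smooth_flat.
  by apply/funext => x; congr e; ring.
- move=> x y xy; rewrite ler_pdivrMr// mulrAC ler_pdivlMr//.
  rewrite !mulrDr (mulrC (e y)) lerD2l.
  by apply: ler_pM => //; [exact: eh|apply: eh; lra].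
- by move=> x /e_0 ->; rewrite mul0r.
- move=> x dx; rewrite (e_0 (d - x)) ?addr0 ?divff ?gt_eqF ?e_gt0//; lra.
Qed.

End smooth_step.

(** * Bochner integrals tested with a fixed vector *)

Section bochner.
Context {R : realType}.
Notation mu := (@lebesgue_measure R).
Notation intD D f := (mu.-integrable D (EFin \o f)).

(** The integral of a nonnegative function is a supremum over simple functions
    below it, hence monotone in the domain even for functions that are not
    measurable. The errors in the definition of the Bochner integral are of
    this kind. *)
Lemma ge0_integral_subset_nomeas (D E : set R) (f : R -> \bar R) :
  E `<=` D -> (forall t, 0 <= f t)%E ->
  (\int[mu]_(t in E) f t <= \int[mu]_(t in D) f t)%E.
Proof.
move=> ED f0; rewrite !ge0_integralE//; apply: ereal_sup_le => _ [h /= hf <-].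
exists h => // t.
apply: le_trans (hf t) _; rewrite !patchE; case: ifPn => [|_].
  by rewrite inE => /ED Dt; rewrite mem_set.
by case: ifPn.
Qed.

(** A simple function takes finitely many values, so measurability of a
    composite does not depend on [Phi]. *)
Lemma measurable_simple_comp n (A : 'I_n -> set (measurableTypeR R)) (x : 'I_n -> L2 R)
    (Phi : L2 R -> R) : (forall i, measurable (A i)) ->
  measurable_fun setT (fun t : R => Phi (\sum_(i < n) \1_(A i) t *: x i)).
Proof.
elim: n A x Phi => [|n IH] A x Phi mA.
  rewrite (_ : (fun t => _) = fun=> Phi 0)//.
  by apply/funext => t; rewrite big_ord0.
set S := fun t => \sum_(i < n) \1_(A (widen_ord (leqnSn n) i)) t *: x (widen_ord (leqnSn n) i).
rewrite (_ : (fun t => _) = fun t => \1_(A ord_max) t * Phi (S t + x ord_max) +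
    (1 - \1_(A ord_max) t) * Phi (S t)).
  apply: measurable_funD; apply: measurable_funM.
  - by apply: measurable_indic; exact: mA.
  - by apply: (IH _ _ (fun u => Phi (u + x ord_max))) => i; exact: mA.
  - by apply: measurable_funB => //; apply: measurable_indic; exact: mA.
  - by apply: (IH _ _ Phi) => i; exact: mA.
apply/funext => t; rewrite big_ord_recr/= -/(S t) indicE.
by case: (_ \in _); rewrite ?scale1r ?scale0r ?mul1r ?mul0r ?subrr ?subr0 ?mul0r ?mul1r ?addr0 ?add0r.
Qed.

Lemma simple_integral n (A : 'I_n -> set (measurableTypeR R)) (c : 'I_n -> R)
    (D : set (measurableTypeR R)) : measurable D -> (mu D < +oo)%E ->
  (forall i, measurable (A i)) ->
  intD D (fun t => \sum_(i < n) \1_(A i) t * c i) /\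
  \int[mu]_(t in D) (\sum_(i < n) \1_(A i) t * c i) =
    \sum_(i < n) fine (mu (A i `&` D)) * c i.
Proof.
move=> mD Doo; have i1 B : measurable B -> intD D (\1_B : R -> R).
  move=> mB; apply: measurable_bounded_integrable => //.
  exists 1; split; first exact: num_real.
  move=> M M1 t _ /=; rewrite indicE; case: (_ \in _); rewrite ?normr1 ?normr0 ltW//.
  by apply: lt_trans M1.
elim: n A c => [|n IH] A c mA.
  rewrite big_ord0; under eq_Rintegral do rewrite big_ord0.
  split; last by rewrite Rintegral_cst// mul0r.
  rewrite (_ : _ \o _ = cst 0%E); first exact: integrable0.
  by apply/funext => t /=; rewrite big_ord0.
have [IH1 IH2] := IH (fun i => A (widen_ord (leqnSn n) i))
  (fun i => c (widen_ord (leqnSn n) i)) (fun i => mA _).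
have im : intD D (fun t => \1_(A ord_max) t * c ord_max).
  rewrite (_ : _ \o _ = (fun t => (c ord_max)%:E * (\1_(A ord_max) t)%:E)%E).
    exact: integrableZl (i1 _ (mA _)).
  by apply/funext => t /=; rewrite mulrC EFinM.
split.
  have := integrableD mD IH1 im; congr (mu.-integrable D).
  by apply/funext => t /=; rewrite big_ord_recr.
under eq_Rintegral do rewrite big_ord_recr/=.
rewrite RintegralD// IH2 big_ord_recr/=; congr (_ + _).
rewrite RintegralZr//; last by apply: i1; exact: mA.
by rewrite /Rintegral integral_indic//; exact: mA.
Qed.

Lemma L2inner_sum n (phi : L2 R) (x : 'I_n -> L2 R) (a : 'I_n -> R) :
  L2inner phi (\sum_(i < n) a i *: x i) = \sum_(i < n) a i * L2inner phi (x i).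
Proof.
elim: n x a => [|n IH] x a.
  by rewrite !big_ord0 -(scale0r (0 : L2 R)) L2innerZr mul0r.
by rewrite !big_ord_recr/= L2innerDr IH L2innerZr.
Qed.

Lemma L2norm_dist (a b c : L2 R) : `|L2norm (a - c) - L2norm (b - c)| <= L2norm (a - b).
Proof.
have H (x y : L2 R) : L2norm (x - c) - L2norm (y - c) <= L2norm (x - y).
  rewrite lerBlDr (_ : x - c = (x - y) + (y - c)); first exact: L2normD.
  by rewrite addrA subrK.
rewrite ler_norml H andbT lerNl opprB.
by rewrite (le_trans (H b a))// -L2normN opprB.
Qed.

Lemma mulr_shrink (a e : R) : 0 <= a -> 0 <= e -> a * (e / (a + 1)) <= e.
Proof.
move=> a0 e0; rewrite mulrCA ler_piMr// ler_pdivrMr ?ltr_wpDl//.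
by rewrite mul1r lerDl.
Qed.

(** Pairing with [phi] turns a Bochner integral into a Lebesgue integral. The
    pairing is a pointwise limit of simple functions off a null set only, so
    it has to be redefined on that set to become measurable. *)
Lemma Bochner_scalarize (D : set (measurableTypeR R)) (f : R -> L2 R) (I phi : L2 R) :
  measurable D -> (mu D < +oo)%E -> has_Bochner_integral D f I ->
  exists y : R -> R, [/\ intD D y,
    {ae mu, forall t : R, D t -> y t = L2inner phi (f t)} &
    \int[mu]_(t in D) y t = L2inner phi I].
Proof.
move=> mD Doo [[s' s'f] [s [sf sI]]].
have [N [mN N0 Nsub]] := s'f.
pose E := D `\` N; have mE : measurable E by exact: measurableD.
have ED : E `<=` D by exact: subDsetl.
have Eoo : (mu E < +oo)%E.
  by apply: le_lt_trans Doo; apply: le_measure; rewrite ?inE.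
have s'E t : E t -> L2norm (f t - simple_fun (s' n) t) @[n --> \oo] --> (0 : R).
  move=> [Dt Nt]; apply: contrapT => H; apply: Nt; apply: Nsub => /= H2.
  exact/H/H2.
pose z n t := L2norm (f t - simple_fun (s n) t).
(* Off the null set, [z n] is the limit of its analogues for the simple
   functions [s' m]. *)
have mz n : measurable_fun E (z n).
  apply: (@measurable_fun_cvg _ _ _ E (fun m t => L2norm (simple_fun (s' m) t - simple_fun (s n) t))).
    move=> m; apply: measurable_funTS.
    pose Sm := s' m; pose Sn := s n.
    have := @measurable_simple_comp (simple_size Sm + simple_size Sn)
      (fun i => match fintype.split i with inl j => simple_set j | inr j => simple_set j end)
      (fun i => match fintype.split i with inl j => simple_val j | inr j => - simple_val j end)
      (@L2norm R) _.
    rewrite (_ : (fun t => _) = fun t => L2norm (simple_fun (s' m) t - simple_fun (s n) t)).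
      by apply => i; case: (fintype.split i) => j; exact: simple_meas.
    apply/funext => t; congr L2norm; rewrite big_split_ord/= /simple_fun -sumrN.
    congr (_ + _); apply: eq_bigr => i _.
      by rewrite -[lshift _ i]/(unsplit (inl i)) unsplitK.
    by rewrite -[rshift _ i]/(unsplit (inr i)) unsplitK scalerN.
  move=> t Et; apply/cvgrPdist_le => /= e e0.
  have /cvgrPdist_le/(_ _ e0) := s'E t Et; apply: filterS => m.
  rewrite sub0r normrN ger0_norm ?L2norm_ge0//; apply: le_trans.
  exact: L2norm_dist.
have inner_dist n t : `|L2inner phi (f t) - L2inner phi (simple_fun (s n) t)| <=
    L2norm phi * z n t.
  by rewrite -L2innerBr; exact: L2_CauchySchwarz.
pose y0 t := L2inner phi (f t).
have my0 : measurable_fun E y0.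
  apply: (@measurable_fun_cvg _ _ _ E (fun m t => L2inner phi (simple_fun (s' m) t))).
    move=> m; apply: measurable_funTS.
    exact: measurable_simple_comp (@simple_meas _ _).
  move=> t Et; apply/cvgrPdist_le => /= e e0.
  have p1 : 0 < L2norm phi + 1 by rewrite ltr_wpDl// L2norm_ge0.
  have /cvgrPdist_le/(_ _ (divr_gt0 e0 p1)) := s'E t Et; apply: filterS => m.
  rewrite sub0r normrN ger0_norm ?L2norm_ge0// => H.
  rewrite -L2innerBr (le_trans (L2_CauchySchwarz _ _))//.
  apply: le_trans (ler_wpM2l (L2norm_ge0 _) H) _.
  exact: mulr_shrink (L2norm_ge0 _) (ltW e0).
pose c n (i : 'I_(simple_size (s n))) := L2inner phi (simple_val i).
have snE n t : L2inner phi (simple_fun (s n) t) =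
    \sum_(i < simple_size (s n)) \1_(simple_set i) t * c n i.
  exact: L2inner_sum.
have isn n : intD D (fun t => L2inner phi (simple_fun (s n) t)).
  have [H _] := simple_integral (c n) mD Doo (@simple_meas _ (s n)).
  by move: H; congr (mu.-integrable D); apply/funext => t /=; rewrite snE.
have Isn n : \int[mu]_(t in D) L2inner phi (simple_fun (s n) t) =
    L2inner phi (simple_int D (s n)).
  have [_ H] := simple_integral (c n) mD Doo (@simple_meas _ (s n)).
  under eq_Rintegral do rewrite snE.
  by rewrite H /simple_int L2inner_sum.
have isnE n : intD E (fun t => L2inner phi (simple_fun (s n) t)).
  exact: integrableS (isn n).
have zfin : \forall n \near \oo, (\int[mu]_(t in E) (z n t)%:E < +oo)%E.
  have H : nbhs (0%E : \bar R) (fun u => u < 1%E)%E by exact: open_ereal_lt'.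
  have {}H : \forall n \near \oo, (\int[mu]_(t in D) (z n t)%:E < 1)%E := sf _ H.
  apply: filterS H => n Hn.
  apply: le_lt_trans (lt_trans Hn (ltry _)).
  by apply: ge0_integral_subset_nomeas => // t; rewrite lee_fin L2norm_ge0.
have iz : \forall n \near \oo, intD E (z n).
  apply: filterS zfin => n zn; apply/integrableP; split; first exact/measurable_EFinP.
  by under eq_integral do rewrite /= ger0_norm ?L2norm_ge0//.
have iy0 : intD E y0.
  have [n izn] := filter_ex iz.
  pose b t := L2norm phi * z n t + `|L2inner phi (simple_fun (s n) t)|.
  have ib : intD E b.
    have i1 : intD E (fun t => L2norm phi * z n t) by exact: (integrableZl mE _ izn).
    by have := integrableD mE i1 (integrable_norm (isnE n)).
  apply: (le_integrable mE _ _ ib); first exact/measurable_EFinP.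
  move=> t Et /=; rewrite lee_fin [leRHS]ger0_norm; last first.
    by rewrite addr_ge0// mulr_ge0 ?L2norm_ge0.
  rewrite -lerBlDr (le_trans _ (inner_dist n t))//.
  exact: lerB_dist.
have Iy0 : \int[mu]_(t in E) y0 t = L2inner phi I.
  have c1 : L2inner phi (simple_int D (s n)) @[n --> \oo] --> L2inner phi I.
    apply/cvgrPdist_le => /= e e0.
    have p1 : 0 < L2norm phi + 1 by rewrite ltr_wpDl// L2norm_ge0.
    have /cvgrPdist_le/(_ _ (divr_gt0 e0 p1)) := sI; apply: filterS => m.
    rewrite sub0r normrN ger0_norm ?L2norm_ge0// => H.
    rewrite distrC -L2innerBr (le_trans (L2_CauchySchwarz _ _))//.
    apply: le_trans (ler_wpM2l (L2norm_ge0 _) H) _.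
    exact: mulr_shrink (L2norm_ge0 _) (ltW e0).
  suff c2 : L2inner phi (simple_int D (s n)) @[n --> \oo] --> \int[mu]_(t in E) y0 t.
    by rewrite -(cvg_lim _ c2)// (cvg_lim _ c1).
  apply/cvgrPdist_le => /= e e0.
  have p1 : 0 < L2norm phi + 1 by rewrite ltr_wpDl// L2norm_ge0.
  have H : nbhs (0%E : \bar R) (fun u => u < (e / (L2norm phi + 1))%:E)%E.
    by apply: open_ereal_lt'; rewrite lte_fin divr_gt0.
  have {}H : \forall n \near \oo,
    (\int[mu]_(t in D) (z n t)%:E < (e / (L2norm phi + 1))%:E)%E := sf _ H.
  near=> n.
  have izn : intD E (z n) by near: n.
  have zn : (\int[mu]_(t in D) (z n t)%:E < (e / (L2norm phi + 1))%:E)%E by near: n.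
  rewrite -Isn; have -> : \int[mu]_(t in D) L2inner phi (simple_fun (s n) t) =
      \int[mu]_(t in E) L2inner phi (simple_fun (s n) t).
    congr fine; apply: negligible_integral => //; exact: isn.
  rewrite -RintegralB// (le_trans (le_normr_Rintegral _ _))//.
    exact: (integrableB mE iy0 (isnE n)).
  have zE : \int[mu]_(t in E) z n t <= e / (L2norm phi + 1).
    rewrite -lee_fin /Rintegral fineK; last exact: integrable_fin_num.
    apply: le_trans (ltW zn).
    by apply: ge0_integral_subset_nomeas => // t; rewrite lee_fin L2norm_ge0.
  apply: (@le_trans _ _ (\int[mu]_(t in E) (L2norm phi * z n t))).
    apply: le_Rintegral => //.
    - exact: (integrable_norm (integrableB mE iy0 (isnE n))).
    - exact: (integrableZl mE _ izn).
    - by move=> t _; exact: inner_dist.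
  rewrite RintegralZl//.
  apply: le_trans (ler_wpM2l (L2norm_ge0 _) zE) _.
  exact: mulr_shrink (L2norm_ge0 _) (ltW e0).
pose y := y0 \_ E.
have yE : EFin \o y = (EFin \o y0) \_ E by rewrite restrict_EFin.
have iy : intD D y.
  apply: (integrableS measurableT mD) => //.
  by rewrite yE; apply/(integrable_mkcond _ mE).
exists y; split => //.
- exists N; split => // t /= H; apply: contrapT => Nt; apply: H => Dt.
  by rewrite /y patchE mem_set.
- rewrite -Iy0 /y -Rintegral_mkcondr; congr (Rintegral mu _ _).
  by apply/setIidPr.
Unshelve. all: by end_near. Qed.

End bochner.

(** * Continuous functions with an integrable weak derivative *)

Section mollify.
Context {R : realType}.
Notation mu := (@lebesgue_measure R).
Notation intD D f := (mu.-integrable D (EFin \o f)).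

Lemma continuous_integrable_itvoc (f : R -> R) (a b : R) : continuous f ->
  intD `]a, b] f.
Proof.
move=> cf; apply: (@integrableS _ _ _ mu `[a, b]%classic `]a, b]%classic) => //.
  by apply: subset_itv; rewrite bnd_simp.
apply: continuous_compact_integrable; first exact: segment_compact.
exact: continuous_subspaceT.
Qed.

(** The derivative of a steep smooth step is an approximation of the Dirac
    mass: it is nonnegative, has integral 1 and lives on [[t1, t1 + d]]. *)
Lemma step_derivative_mollify (f : R -> R) (T t1 e : R) : continuous f ->
  0 < t1 -> t1 < T -> 0 < e ->
  exists2 d0, 0 < d0 & forall d P, 0 < d < d0 -> smooth_expr P ->
    {homo P : x y / x <= y} -> (forall x, x <= 0 -> P x = 0) ->
    (forall x, d <= x -> P x = 1) ->
    `|\int[mu]_(t in `]0, T]) (derive1 P (t - t1) * f t) - f t1| <= e.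
Proof.
move=> cf t10 t1T e0.
have /cvgrPdist_le/(_ e e0)/nbhs_ballP[d1 /= d10 Hd1] := cf t1.
exists (Num.min d1 (T - t1)); first by rewrite lt_min d10 subr_gt0.
move=> d P /andP[d0]; rewrite lt_min => /andP[dd1 dT] sP Ph P0 P1.
pose dP := derive1 P.
have cdP : continuous dP by apply: smooth_expr_continuous; exact: smooth_expr_derive1.
have dPE (x : R) : is_derive x 1 P (dP x).
  by apply: DeriveDef; [exact: (@smooth_expr_derivable _ P 0)|rewrite /dP derive1E].
have dP0 x : 0 <= dP x by exact: is_derive_nondecreasing_ge0 (dPE x).
pose Q t := P (t - t1).
have sQ : smooth_expr Q by exact: smooth_expr_shift.
have dQE (x : R) : is_derive x 1 Q (dP (x - t1)).
  rewrite -[dP _]mulr1; apply: (@is_derive1_comp _ P (fun y => y - t1)).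
  have := is_deriveB (@is_derive_id R R^o x 1) (@is_derive_cst R R^o R^o t1 x 1).
  by rewrite subr0.
have cdQ : continuous (fun t => dP (t - t1)).
  by move=> t; apply: continuous_comp; [apply: cvgB => //; exact: cvg_cst|exact: cdP].
have T0 : 0 < T by exact: lt_trans t1T.
have Q1 : \int[mu]_(t in `]0, T]) dP (t - t1) = 1.
  rewrite Rintegral_itv_obnd_cbnd; last exact: continuous_integrable_itvoc.
  rewrite /Rintegral (@continuous_FTC2 _ _ Q)//.
  - rewrite /Q P1; last lra.
    by rewrite (P0 (0 - t1)) ?oppr0 ?addr0 /=; [rewrite ?subr0 ?oppr0 ?addr0 | lra].
  - exact: continuous_subspaceT.
  - split.
    + by move=> x _; exact: (@smooth_expr_derivable _ Q 0).
    + apply: cvg_at_right_filter; exact: smooth_expr_continuous sQ _.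
    + apply: cvg_at_left_filter; exact: smooth_expr_continuous sQ _.
  - by move=> x _; rewrite derive1E; have [_ ->] := dQE x.
have i1 : intD `]0, T] (fun t => dP (t - t1) * f t).
  apply: continuous_integrable_itvoc => t; apply: cvgM; [exact: cdQ|exact: cf].
have i2 : intD `]0, T] (fun t => dP (t - t1)) by exact: continuous_integrable_itvoc.
have i4 c : intD `]0, T] (fun t => dP (t - t1) * c).
  by apply: continuous_integrable_itvoc => t; apply: cvgM; [exact: cdQ|exact: cvg_cst].
have -> : \int[mu]_(t in `]0, T]) (dP (t - t1) * f t) - f t1 =
    \int[mu]_(t in `]0, T]) (dP (t - t1) * (f t - f t1)).
  rewrite -{1}[f t1]mul1r -Q1 -RintegralZr// -RintegralB//.
  by apply: eq_Rintegral => t _; rewrite mulrBr.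
have i3 : intD `]0, T] (fun t => dP (t - t1) * (f t - f t1)).
  apply: continuous_integrable_itvoc => t; apply: cvgM; first exact: cdQ.
  by apply: cvgB; [exact: cf|exact: cvg_cst].
apply: le_trans (le_normr_Rintegral _ i3) _ => //.
rewrite -[leRHS]mul1r -Q1 -RintegralZr//.
apply: le_Rintegral => //; first exact: integrable_norm.
move=> t _; rewrite normrM ger0_norm//.
have near_cst (c x : R) : (\forall y \near x, P y = c) -> dP x = 0.
  move=> H; have H' : \forall y \near x, cst c y = P y by near=> y; rewrite (near H y).
  have := @near_eq_is_derive R R^o R^o (cst c) P x 1 0 H' (is_derive_cst _ _ _).
  by move=> [_ <-]; rewrite /dP derive1E.
have [tt|tt] := ltP t t1.
  rewrite (near_cst 0) ?mul0r//; near=> y; apply: P0; apply: ltW.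
  by near: y; apply: lt_nbhsl; rewrite subr_lt0.
have [td|td] := ltP d (t - t1).
  rewrite (near_cst 1) ?mul0r//; near=> y; apply: P1; apply: ltW.
  by near: y; exact: lt_nbhsr.
rewrite ler_wpM2l// distrC; apply: Hd1; rewrite /ball/= distrC ger0_norm ?subr_ge0//.
exact: le_lt_trans dd1.
Unshelve. all: by end_near. Qed.
End mollify.

Section weak_derivative.
Context {R : realType}.
Notation mu := (@lebesgue_measure R).
Notation intD D f := (mu.-integrable D (EFin \o f)).

Lemma smooth_expr_derive1_is (f : R -> R) (x : R) : smooth_expr f -> is_derive x 1 f (derive1 f x).
Proof.
move=> sf; apply: DeriveDef; [exact: (@smooth_expr_derivable _ f 0)|by rewrite derive1E].
Qed.

Lemma smooth_expr_shift_is_derive (f : R -> R) (c x : R) : smooth_expr f ->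
  is_derive x 1 (fun t => f (t - c)) (derive1 f (x - c)).
Proof.
move=> sf; rewrite -[derive1 _ _]mulr1; apply: (@is_derive1_comp _ f (fun y => y - c)).
  exact: smooth_expr_derive1_is.
have := is_deriveB (@is_derive_id R R^o x 1) (@is_derive_cst R R^o R^o c x 1).
by rewrite subr0.
Qed.

(** Testing the weak derivative with smooth approximations of the indicator of
    [(t1, t2]] recovers the increment on one side, by
    [step_derivative_mollify], and the integral of [y] on the other, by
    dominated convergence. *)
Lemma weak_derivative_FTC (f y : R -> R) (T t1 t2 : R) : continuous f ->
  intD `]0, T] y ->
  (forall theta, test_function T theta ->
    \int[mu]_(t in `]0, T]) (derive1 theta t * f t) =
    - \int[mu]_(t in `]0, T]) (theta t * y t)) ->
  0 < t1 -> t1 < t2 -> t2 < T ->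
  f t2 - f t1 = \int[mu]_(t in `]t1, t2]) y t.
Proof.
move=> cf iy wd t10 t12 t2T.
have t1T := lt_trans t12 t2T; have t20 := lt_trans t10 t12.
have [P HP] := choice (fun n : nat => smooth_step (divr_gt0 ltr01 (ltr0Sn R n))).
pose d n : R := 1 / n.+1%:R.
have d0 n : 0 < d n by rewrite divr_gt0.
have dc : d n @[n --> \oo] --> (0 : R).
  by rewrite (_ : d = fun n => n.+1%:R^-1); [exact: cvg_harmonic|apply/funext => n; rewrite /d div1r].
have dlt e : 0 < e -> \forall n \near \oo, d n < e.
  move=> e0; have /cvgrPdist_lt/(_ e e0) := dc; apply: filterS => n.
  by rewrite sub0r normrN gtr0_norm.
have sP n : smooth_expr (P n) by have [] := HP n.
have hP n : {homo P n : x y / x <= y} by have [] := HP n.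
have P0 n x : x <= 0 -> P n x = 0 by have [_ _ H _] := HP n; exact: H.
have P1 n x : d n <= x -> P n x = 1 by have [_ _ _ H] := HP n; exact: H.
have Pge n x : 0 <= P n x.
  by have [/P0->//|/ltW/(hP n)] := leP x 0; rewrite (P0 n 0).
have Ple n x : P n x <= 1.
  by have [/P1->//|/ltW/(hP n)] := leP (d n) x; rewrite (P1 n (d n)).
(* A smooth approximation of the indicator of [(t1, t2]]. *)
pose th n t := P n (t - t1) - P n (t - t2).
have sth n : smooth_expr (th n).
  rewrite (_ : th n = fun t => P n (t - t1) + (-1) * P n (t - t2)); last first.
    by apply/funext => t; rewrite mulN1r.
  apply: smooth_add; first exact: smooth_expr_shift.
  by apply: smooth_mul; [exact: smooth_cst|exact: smooth_expr_shift].
have dth n : derive1 (th n) = fun t => derive1 (P n) (t - t1) - derive1 (P n) (t - t2).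
  apply/funext => t; rewrite derive1E.
  have := is_deriveB (smooth_expr_shift_is_derive t1 t (sP n)) (smooth_expr_shift_is_derive t2 t (sP n)).
  by move=> [].
have thT : \forall n \near \oo, test_function T (th n).
  have Tt2 : 0 < T - t2 by rewrite subr_gt0.
  apply: filterS (dlt _ Tt2) => n dn; split; first by move=> k x; exact: smooth_expr_derivable.
  exists t1, (t2 + d n); split => //; first lra.
  move=> x; rewrite in_itv/= negb_and -!ltNge /th => /orP[xt1|xt2].
    by rewrite !P0 ?subrr//; lra.
  by rewrite !P1 ?subrr//; lra.
have cA : \int[mu]_(t in `]0, T]) (derive1 (th n) t * f t) @[n --> \oo] --> f t1 - f t2.
  have key t0 : 0 < t0 -> t0 < T ->
      \int[mu]_(t in `]0, T]) (derive1 (P n) (t - t0) * f t) @[n --> \oo] --> f t0.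
    move=> t00 t0T; apply/cvgrPdist_le => /= e e0.
    have [e1 e10 H] := step_derivative_mollify cf t00 t0T e0.
    apply: filterS (dlt _ e10) => n dn; rewrite distrC.
    by apply: (H (d n) (P n) _ (sP n) (hP n) (P0 n) (P1 n)); rewrite d0.
  rewrite (_ : (fun n => _) = fun n =>
      \int[mu]_(t in `]0, T]) (derive1 (P n) (t - t1) * f t) -
      \int[mu]_(t in `]0, T]) (derive1 (P n) (t - t2) * f t)).
    by apply: cvgB; apply: key.
  apply/funext => n.
  have ii t0 : intD `]0, T] (fun t => derive1 (P n) (t - t0) * f t).
    apply: continuous_integrable_itvoc => t; apply: cvgM; last exact: cf.
    apply: continuous_comp; first by apply: cvgB => //; exact: cvg_cst.
    by apply: smooth_expr_continuous; exact: smooth_expr_derive1.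
  rewrite -RintegralB//.
  by apply: eq_Rintegral => t _; rewrite dth mulrBl.
pose ind t : R := \1_(`]t1, t2]%classic) t.

have cB : \int[mu]_(t in `]0, T]) (th n t * y t) @[n --> \oo] -->
    \int[mu]_(t in `]0, T]) (ind t * y t).
  have mth n : measurable_fun `]0, T] (th n).
    by apply: measurable_funTS; apply: continuous_measurable_fun; exact: smooth_expr_continuous.
  have mind : measurable_fun `]0, T] ind by exact: measurable_indic.
  have my' : measurable_fun `]0, T] y by have /integrableP[/measurable_EFinP] := iy.
  have th1 n t : `|th n t| <= 1.
    rewrite ler_norml /th; have := Pge n (t - t1); have := Pge n (t - t2).
    have := Ple n (t - t1); have := Ple n (t - t2); lra.
  have iind : intD `]0, T] (fun t => ind t * y t).
    apply: (le_integrable _ _ _ iy) => //.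
      by apply/measurable_EFinP; exact: measurable_funM.
    move=> t _ /=; rewrite lee_fin normrM ler_piMl// /ind indicE.
    by case: (_ \in _); rewrite ?normr1 ?normr0.
  apply: fine_cvg; rewrite fineK; last exact: integrable_fin_num.
  apply: (@dominated_cvg _ _ _ mu `]0, T]%classic _ (fun n t => (th n t * y t)%:E) _ (fun t => `|(y t)%:E|)%E).
  - by [].
  - by move=> n; apply/measurable_EFinP; exact: (measurable_funM (mth n) my').
  - move=> t _ /=; apply: cvg_EFin; first exact: nearW.
    apply: cvgM; last exact: cvg_cst.
    have [tt1|tt1] := leP t t1.
      rewrite (_ : ind t = 0); last by rewrite /ind indicE memNset//= in_itv/= ltNge tt1.
      rewrite (_ : (fun n => th n t) = fun=> 0); first exact: cvg_cst.
      by apply/funext => n; rewrite /th !P0 ?subrr//; lra.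
    have tt10 : 0 < t - t1 by rewrite subr_gt0.
    have [tt2|tt2] := leP t t2.
      rewrite (_ : ind t = 1); last by rewrite /ind indicE mem_set//= in_itv/= tt1 tt2.
      apply: cvg_near_cst; apply: filterS (dlt _ tt10) => n dn.
      by rewrite /th P1 ?P0 ?subr0//; lra.
    have tt20 : 0 < t - t2 by rewrite subr_gt0.
    rewrite (_ : ind t = 0); last by rewrite /ind indicE memNset//= in_itv/= tt1 leNgt tt2.
    apply: cvg_near_cst; apply: filterS (dlt _ tt20) => n dn.
    by rewrite /th !P1 ?subrr//; lra.
  - by [].
  - exact: (integrable_norm iy).
  - move=> n t _; rewrite lee_fin normrM ler_piMl//.
have cAB : \int[mu]_(t in `]0, T]) (derive1 (th n) t * f t) @[n --> \oo] -->
    - \int[mu]_(t in `]0, T]) (ind t * y t).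
  apply: cvg_trans (cvgN cB); apply: near_eq_cvg.
  by apply: filterS thT => n /wd ->.
have E : f t1 - f t2 = - \int[mu]_(t in `]0, T]) (ind t * y t).
  by rewrite -(cvg_lim _ cA)// (cvg_lim _ cAB).
rewrite -opprB E opprK.
have -> : `]t1, t2]%classic = (`]0, T] `&` `]t1, t2])%classic.
  apply/esym/setIidPr => x /=; rewrite !in_itv/= => /andP[? ?].
  by apply/andP; split; lra.
rewrite Rintegral_mkcondr; apply: eq_Rintegral => t _.
rewrite patchE /ind indicE; by case: ifPn => _; rewrite ?mul1r ?mul0r.
Qed.

End weak_derivative.

(** * Displacements of strong solutions *)

Section increment.
Context {R : realType}.
Notation mu := (@lebesgue_measure R).
Notation intD D f := (mu.-integrable D (EFin \o f)).

Lemma strong_derivative_inner (g : R -> L2 R) (phi v : L2 R) (t : R) :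
  is_strong_derivative g t v ->
  is_derive t 1 (fun r => L2inner phi (g r)) (L2inner phi v).
Proof.
move=> gv.
have cv : (fun h => h^-1 *: (L2inner phi (g (h *: 1 + t)) - L2inner phi (g t))) @ 0^'
    --> (L2inner phi v : R).
  apply/cvgrPdist_le => /= e e0.
  have p1 : 0 < L2norm phi + 1 by rewrite ltr_wpDl// L2norm_ge0.
  have /cvgrPdist_le/(_ _ (divr_gt0 e0 p1)) := gv; apply: filterS => h.
  rewrite sub0r normrN ger0_norm ?L2norm_ge0// => H.
  rewrite distrC /GRing.scale/= mulr1 (addrC h) -L2innerBr -L2innerZr -L2innerBr.
  apply: le_trans (L2_CauchySchwarz _ _) _.
  by apply: le_trans (ler_wpM2l (L2norm_ge0 _) H) _; exact: mulr_shrink (L2norm_ge0 _) (ltW e0).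
by apply: DeriveDef; [apply/cvg_ex; exists (L2inner phi v)|exact: cvg_lim cv].
Qed.

Variables (F : L2 R -> R) (g0 : L2 R) (g : R -> L2 R).
Hypothesis sol : strong_solution F g0 g.
Variable phi : L2 R.

(* The trajectory is controlled for nonnegative times; freezing it before
   time 0 makes the pairing continuous on the whole line. *)
Let f (t : R) := L2inner phi (g (Num.max 0 t)).

Let f_cont : continuous f.
Proof.
move=> t; apply/cvgrPdist_le => /= e e0.
have p1 : 0 < L2norm phi + 1 by rewrite ltr_wpDl// L2norm_ge0.
have [_ gc _ _] := sol.
have m0 : 0 <= Num.max 0 t by rewrite le_max lexx.
have /cvgrPdist_le/(_ _ (divr_gt0 e0 p1))/nbhs_ballP[d /= d0 Hd] := gc _ m0.
apply/nbhs_ballP; exists d => //= s; rewrite /ball/= => ts.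
have s0 : 0 <= Num.max 0 s by rewrite le_max lexx.
have := Hd (Num.max 0 s); rewrite /ball/= in_itv/= s0 => /(_ _ isT)/wrap[].
  apply: le_lt_trans ts.
  have h1 := ler_norm (t - s); have h2 := ler_norm (- (t - s)); rewrite normrN in h2.
  by rewrite ler_norml; case: (leP 0 t) => ?; case: (leP 0 s) => ?; apply/andP; split; lra.
rewrite sub0r normrN ger0_norm ?L2norm_ge0// => H.
rewrite /f distrC -L2innerBr; apply: le_trans (L2_CauchySchwarz _ _) _.
by apply: le_trans (ler_wpM2l (L2norm_ge0 _) H) _; exact: mulr_shrink (L2norm_ge0 _) (ltW e0).
Qed.

(** Pairings of the trajectory are primitives of their weak derivative, and
    Lebesgue differentiation identifies the weak derivative with the strong
    one almost everywhere. This rules out a singular part of the motion. *)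
Lemma inner_increment_integral (T : R) : 0 < T -> exists y : R -> R,
  [/\ intD setT y, forall t1 t2, 0 < t1 -> t1 < t2 -> t2 < T ->
    f t2 - f t1 = \int[mu]_(t in `]t1, t2]) y t &
    {ae mu, forall t, 0 < t < T -> forall v, is_strong_derivative g t v ->
       y t = L2inner phi v}].
Proof.
move=> T0; have [W _ _ _] := sol.
have [_ [w [Iw wI] wd]] := W _ T0.
have mD : measurable (`]0, T]%classic : set (measurableTypeR R)) by exact: measurable_itv.
have Doo : (mu `]0%R, T] < +oo)%E.
  by rewrite lebesgue_measure_itv/=; case: ifPn => _; rewrite ?ltry// -EFinB ltry.
have [y0 [iy0 y0E _]] := Bochner_scalarize phi mD Doo wI.
pose y := y0 \_ `]0, T].
have iy : intD setT y.
  have yE : EFin \o y = (EFin \o y0) \_ `]0, T] by rewrite restrict_EFin.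
  by rewrite yE; apply/(integrable_mkcond _ mD).
have FTC t1 t2 : 0 < t1 -> t1 < t2 -> t2 < T ->
    f t2 - f t1 = \int[mu]_(t in `]t1, t2]) y t.
  move=> t10 t12 t2T.
  rewrite (weak_derivative_FTC f_cont iy0 _ t10 t12 t2T).
    apply: eq_Rintegral => t; rewrite inE/= in_itv/= => /andP[a b].
    by rewrite /y patchE mem_set//= in_itv/=; apply/andP; split; lra.
  move=> theta th; have [I [I1 I2]] := wd theta th.
  have [y1 [iy1 y1E y1I]] := Bochner_scalarize phi mD Doo I1.
  have [y2 [iy2 y2E y2I]] := Bochner_scalarize phi mD Doo I2.
  have [th_smooth [a [b [a0 bT thab]]]] := th.
  have cth : continuous theta.
    by move=> s; apply: differentiable_continuous; apply/derivable1_diffP; exact: (th_smooth 0).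
  have cdth : continuous (derive1 theta).
    by move=> s; apply: differentiable_continuous; apply/derivable1_diffP; exact: (th_smooth 1).
  have mono s : `]0, T]%classic s -> Num.max 0 s = s.
    by rewrite /= in_itv/= => /andP[s0 _]; apply/max_idPr; exact: ltW.
  have -> : \int[mu]_(t in `]0, T]) (derive1 theta t * f t) = \int[mu]_(t in `]0, T]) y1 t.
    congr fine; apply: ae_eq_integral => //.
    - have ii : intD `]0, T] (fun t => derive1 theta t * f t).
        by apply: continuous_integrable_itvoc => s; apply: cvgM; [exact: cdth|exact: f_cont].
      by have /integrableP[] := ii.
    - by have /integrableP[] := iy1.
    - apply: filterS y1E => s H Ds; rewrite H// L2innerZr /f mono//.
  have -> : \int[mu]_(t in `]0, T]) (theta t * y0 t) = \int[mu]_(t in `]0, T]) y2 t.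
    congr fine; apply: ae_eq_integral => //.
    - apply/measurable_EFinP; apply: measurable_funM.
        by apply: measurable_funTS; exact: continuous_measurable_fun.
      by have /integrableP[/measurable_EFinP] := iy0.
    - by have /integrableP[] := iy2.
    - apply: filterS2 y0E y2E => s H1 H2 Ds.
      by rewrite H1// H2// L2innerZr.
  by rewrite y1I y2I L2innerNr opprK.
exists y; split => //.
have lf : locally_integrable setT y by apply: open_integrable_locally => //; exact: openT.
have iyS z : intD [set` Interval (BRight 0) (BRight z)] y.
  by apply: integrableS iy.
have := FTC1 iyS lf; apply: filterS => t H /andP[t0 tT] v gv.
have {H}[] := H t0.
set G := (fun x => _) => dG GE.
have t20 : 0 < t / 2 by rewrite divr_gt0.
(* Near [t] the pairing differs from the primitive [G] of [y] by a
   constant; [t / 2] serves as base point because increments are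
   integrals between positive times only. *)
have Gf : \forall s \near t, f (t / 2) + (G s - G (t / 2)) = L2inner phi (g s).
  near=> s; have ts : t / 2 < s by near: s; apply: lt_nbhsr; rewrite ltr_pdivrMr// ltr_pMr// ltr1n.
  have sT : s < T by near: s; exact: lt_nbhsl.
  have s0 := lt_trans t20 ts.
  have <- : f s = L2inner phi (g s) by rewrite /f (max_idPr (ltW s0)).
  have := FTC _ _ t20 ts sT.
  rewrite -(@Rintegral_itvB _ _ (BRight 0) (BRight s) (t / 2))//.
  - by rewrite -/(G s) -/(G (t / 2)); lra.
  - by rewrite bnd_simp ltW.
  - by rewrite bnd_simp ltW.
have dG' : is_derive t 1 (fun s => f (t / 2) + (G s - G (t / 2))) (y t).
  have dGt : is_derive t 1 G (y t) by apply: DeriveDef; rewrite -?derive1E.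
  have := is_deriveD (@is_derive_cst R R^o R^o (f (t / 2)) t 1)
    (is_deriveB dGt (@is_derive_cst R R^o R^o (G (t / 2)) t 1)).
  by rewrite subr0 add0r.
have [_ <-] := @near_eq_is_derive R R^o R^o _ _ t 1 _ Gf dG'.
by have [_ ->] := strong_derivative_inner phi gv.
Unshelve. all: by end_near. Qed.

Lemma strong_solution_increment_gt0 (K t1 t2 : R) : 0 < t1 -> t1 < t2 ->
  (forall r v, t1 < r < t2 -> subdifferential F (g r) (- v) -> L2inner phi v <= K) ->
  L2inner phi (g t2 - g t1) <= K * (t2 - t1).
Proof.
move=> t10 t12 HK; have T0 : 0 < t2 + 1 by rewrite ltr_wpDl//; lra.
have [y [iy FTC yv]] := inner_increment_integral T0.
have t20 := lt_trans t10 t12.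
have t2T : t2 < t2 + 1 by rewrite ltrDl.
have := FTC _ _ t10 t12 t2T.
rewrite /f !(max_idPr (ltW _))// -L2innerBr => ->.
have [_ _ _ dsol] := sol.
have mD : measurable (`]t1, t2[%classic : set (measurableTypeR R)) by exact: measurable_itv.
have iyD : intD `]t1, t2[ y by apply: integrableS iy.
rewrite -Rintegral_itv_bndo_bndc//.
have lam : lebesgue_measure (`]t1, t2[%classic : set R) = (t2 - t1)%:E.
  by rewrite lebesgue_measure_itv/= lte_fin t12 -EFinB.
have -> : K * (t2 - t1) = \int[mu]_(t in `]t1, t2[) K.
  by rewrite Rintegral_cst// -[t2 - t1]/(fine (t2 - t1)%:E) -lam.
have iK : intD `]t1, t2[ (fun=> K).
  apply: measurable_bounded_integrable => //.
    by apply: (@le_lt_trans _ _ (t2 - t1)%:E); rewrite ?ltry// -lam.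
  by exists `|K|; split; [exact: num_real|move=> M KM s _ /=; exact: ltW].
rewrite -subr_ge0 -RintegralB//.
have ii : intD `]t1, t2[ (fun t => K - y t) by exact: (integrableB mD iK iyD).
suff -> : \int[mu]_(t in `]t1, t2[) (K - y t) = \int[mu]_(t in `]t1, t2[) `|K - y t|.
  by apply: Rintegral_ge0.
congr fine; apply: ae_eq_integral => //.
- by have /integrableP[] := ii.
- by have /integrableP[] := integrable_norm ii.
apply: filterS2 dsol yv => t H1 H2; rewrite /= in_itv/= => /andP[tt1 tt2].
have t0 : 0 < t by exact: lt_trans tt1.
have [v gv sv] := H1 t0.
rewrite ger0_norm// subr_ge0 (H2 _ _ gv); last by rewrite t0/=; lra.
by apply: HK sv; rewrite tt1.
Qed.

(** A bound on the admissible velocities in the direction [phi] bounds the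
    displacement in this direction. This is the form in which the evolution
    inclusion is used. *)
Lemma strong_solution_increment (K t1 t2 : R) : 0 <= t1 -> t1 <= t2 ->
  (forall r v, t1 < r < t2 -> subdifferential F (g r) (- v) -> L2inner phi v <= K) ->
  L2inner phi (g t2 - g t1) <= K * (t2 - t1).
Proof.
rewrite le_eqVlt => /predU1P[<-|t10] t12 HK; last first.
  move: t12; rewrite le_eqVlt => /predU1P[<-|t12].
    by rewrite !subrr mulr0 -(scale0r (0 : L2 R)) L2innerZr mul0r.
  exact: strong_solution_increment_gt0.
move: t12; rewrite le_eqVlt => /predU1P[<-|t20].
  by rewrite !subrr mulr0 -(scale0r (0 : L2 R)) L2innerZr mul0r.
have H s : 0 < s -> s < t2 -> f t2 - f s <= K * (t2 - s).
  move=> s0 st2; rewrite /f !(max_idPr (ltW _))// -L2innerBr.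
  apply: strong_solution_increment_gt0 => // r v /andP[sr rt] .
  by apply: HK; rewrite rt (lt_trans s0).
have -> : L2inner phi (g t2 - g 0) = f t2 - f 0.
  by rewrite L2innerBr /f maxxx (max_idPr (ltW t20)).
have c1 : (fun s => f t2 - f s) s @[s --> 0^'+] --> f t2 - f 0.
  apply: cvg_at_right_filter; apply: cvgB; [exact: cvg_cst|exact: f_cont].
have c2 : (fun s => K * (t2 - s)) s @[s --> 0^'+] --> K * (t2 - 0).
  apply: cvg_at_right_filter; apply: cvgM; first exact: cvg_cst.
  by apply: cvgB => //; exact: cvg_cst.
apply: ler_cvg_to c1 c2 _; near=> s; apply: H => //.
Unshelve. all: by end_near. Qed.

End increment.

(** * Comparison of two levels of the solution *)

Section monotone.
Context {R : realType}.
Notation m01 := (lebesgue01 R).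
Notation mu := (@lebesgue_measure R).
Implicit Types u v w p : L2 R.

(** Translates of null sets are null. *)
Lemma ae01_shift (h : R) (X : R -> Prop) : {ae m01, forall s, X s} ->
  {ae m01, forall s, window h s -> X (s + h)}.
Proof.
move=> [N [mN N0 NX]].
pose A : set (measurableTypeR R) := N `&` `]0, 1[.
have mA : measurable A by apply: measurableI => //; exact: measurable_itv.
pose N' : set (measurableTypeR R) := (fun s : R => s - (- h)) @^-1` A.
have mN' : measurable N'.
  by rewrite -[N']setTI; exact: (measurable_translation (- h)).
have N'0 : mu N' = 0%E.
  by have := lebesgue_measure_shift (- h) mA; rewrite /pushforward => ->.
exists N'; split => //.
- apply/eqP; rewrite eq_le measure_ge0 andbT -N'0 lebesgue01E le_measure// ?inE//.
  by apply: measurableI => //; exact: measurable_itv.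
- move=> s /= H; have /not_implyP[/andP[s1 s2] nX] := H.
  by split; [rewrite opprK; exact: NX|rewrite opprK /= in_itv/=].
Qed.

Lemma posL2_subproof (u : L2 R) : (fun s : R => Num.max 0 (u s)) \in Lfun m01 2%:E.
Proof.
apply: Lfun2_le (L2_mem u); first by apply: measurable_maxr => //; exact: L2_meas.
by move=> s; rewrite ger0_norm ?le_max ?lexx// ge_max normr_ge0 ler_norm.
Qed.
Definition posL2 u : L2 R := mkL2 (posL2_subproof u).
Lemma posL2E u s : posL2 u s = Num.max 0 (u s). Proof. by []. Qed.
Lemma posL2_ge0 u (s : R) : 0 <= posL2 u s.
Proof. by rewrite posL2E le_max lexx. Qed.

Lemma measurable_window h : measurable_fun setT (window h : R -> bool).
Proof.
have -> : window h = fun s : R => ((0 < s) && (s < 1)) && ((0 < s + h) && (s + h < 1)) :> bool by [].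
by apply: measurable_and; apply: measurable_and; apply: measurable_fun_ltr => //; exact: measurable_funD.
Qed.

Lemma restrL2_subproof h (u : L2 R) :
  (fun s : R => if window h s then u s else 0) \in Lfun m01 2%:E.
Proof.
apply: Lfun2_le (L2_mem u) => [|s]; last by case: ifPn; rewrite ?normr0.
apply: measurable_fun_ifT => //; [exact: measurable_window|exact: L2_meas].
Qed.
Definition restrL2 h u : L2 R := mkL2 (restrL2_subproof h u).
Lemma restrL2E h u s : restrL2 h u s = if window h s then u s else 0.
Proof. by []. Qed.
Lemma restrL2_out h u s : ~~ window h s -> restrL2 h u s = 0.
Proof. by rewrite restrL2E => /negbTE->. Qed.

Lemma windowN (h s : R) : window (- h) (s + h) = window h s.
Proof. by rewrite /window addrK andbC. Qed.

Definition incrL2 h u : L2 R := shiftL2 (@restrL2_out (- h) u) - restrL2 h u.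
Lemma incrL2E h u s : incrL2 h u s = if window h s then u (s + h) - u s else 0.
Proof.
rewrite L2_subE shiftL2E !restrL2E opprK windowN.
by case: ifPn => //; rewrite subrr.
Qed.

(** Testing an increment with [p] amounts to testing the function itself with
    the difference of [p] and its translate, the direction considered in
    [subdifferential_shift]. *)
Lemma L2inner_incr h p u (pw : forall s, ~~ window h s -> p s = 0) :
  L2inner p (incrL2 h u) = L2inner (shiftL2 pw - p) u.
Proof.
have -> : L2inner (shiftL2 pw - p) u = L2inner (shiftL2 pw) u - L2inner p u.
  by rewrite L2innerC L2innerBr !(L2innerC u).
rewrite L2inner_shift -RintegralB//.
- apply: eq_Rintegral => s _; rewrite incrL2E -mulrBr.
  by case: ifPn => // /pw ->; rewrite !mul0r.
- exact: int01_shiftM pw u.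
- exact: L2_intM.
Qed.

Lemma affL2_subproof (a b : R) : (fun s : R => a + b * s) \in Lfun m01 2%:E.
Proof.
have mf : measurable_fun setT (fun s : R => a + b * s).
  by apply: measurable_funD => //; exact: measurable_funM.
apply: Lfun2P => //; apply: (@int01_le _ _ (fun=> (`|a| + `|b|) ^+ 2)).
- exact: measurable_funX.
- exact: int01_cst.
- apply: ae01 => s /andP[s0 s1]; rewrite normrX lerXn2r ?nnegrE ?addr_ge0//.
  rewrite (le_trans (ler_normD _ _))// lerD2l normrM ler_piMr//.
  by rewrite gtr0_norm// ltW.
Qed.
Definition affL2 (a b : R) : L2 R := mkL2 (affL2_subproof a b).
Lemma affL2E a b s : affL2 a b s = a + b * s. Proof. by []. Qed.

(** The pairing is the square norm of the positive part. *)
Lemma posL2_inner0 u : L2inner (posL2 u) u <= 0 -> {ae m01, forall s, u s <= 0}.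
Proof.
move=> H; have : {ae m01, forall s, posL2 u s * u s = 0}.
  apply: Rint01_eq0 => //; first exact: L2_intM.
  apply: nearW => s; rewrite posL2E; case: (leP 0 (u s)) => [u0|u0].
    exact: mulr_ge0.
  by rewrite mul0r.
apply: filterS => s; rewrite posL2E; case: (leP 0 (u s)) => [u0 /eqP|/ltW//].
by rewrite mulf_eq0 orbb => /eqP->.
Qed.

Section solution.
Variable nu : probability (measurableTypeR R) R.
Variables (g0 : L2 R) (g : R -> L2 R).
Hypothesis sol : strong_solution (F_ nu) g0 g.

(** The velocity bounds of [subdifferential_bound], integrated in time: an
    upper bound [2 s (t2 - t1)] for [sg = 1] and a lower bound [- 2 (1 - s)
    (t2 - t1)] for [sg = -1]. *)
Lemma solution_increment_signed (sg t1 t2 : R) : `|sg| = 1 -> 0 <= t1 -> t1 <= t2 ->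
  {ae m01, forall s, sg * (g t2 s - g t1 s) <= (t2 - t1) * (1 - sg * (1 - 2 * s))}.
Proof.
move=> sg1 t10 t12; have sg2 : sg * sg = 1.
  by rewrite -expr2 -(real_normK (num_real sg)) sg1 expr1n.
pose D := t2 - t1; have D0 : 0 <= D by rewrite subr_ge0.
pose c := affL2 (1 - sg) (2 * sg).
(* Testing with the violation of the bound makes its square norm appear. *)
pose q := posL2 (sg *: (g t2 - g t1) - D *: c).
have K r v : t1 < r < t2 -> subdifferential (F_ nu) (g r) (- v) ->
    L2inner (sg *: q) v <= L2inner q c.
  move=> _ /(subdifferential_bound (sg *: q)) /le_trans; apply.
  apply: Rint01_le; last first.
  - apply: nearW => s; rewrite !L2_scaleE normrM sg1 mul1r ger0_norm ?posL2_ge0//.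
    rewrite affL2E le_eqVlt; apply/orP; left; apply/eqP; ring.
  - exact: L2_intM.
  - apply: int01B; first exact: int01_norm (L2_int _).
    exact: int01_slope (L2_int (sg *: q)).
have H := strong_solution_increment sol t10 t12 K; move: H.
have -> : L2inner (sg *: q) (g t2 - g t1) = sg * L2inner q (g t2 - g t1).
  by rewrite L2innerC L2innerZr L2innerC.
rewrite -/D => H.
have : L2inner q (sg *: (g t2 - g t1) - D *: c) <= 0.
  by rewrite L2innerBr !L2innerZr subr_le0 (mulrC D).
move/posL2_inner0; apply: filterS => s.
rewrite L2_subE !L2_scaleE L2_subE affL2E subr_le0 => /le_trans; apply.
by rewrite /D (_ : 1 - sg + 2 * sg * s = 1 - sg * (1 - 2 * s))//; ring.
Qed.

Lemma solution_dist (t1 t2 : R) : 0 <= t1 -> t1 <= t2 ->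
  {ae m01, forall s, `|g t2 s - g t1 s| <= 2 * (t2 - t1)}.
Proof.
move=> t10 t12.
have n1 : `|-1 : R| = 1 by rewrite normrN normr1.
have H1 := solution_increment_signed (normr1 R) t10 t12.
have H2 := solution_increment_signed n1 t10 t12.
have H01 := @ae01 R (fun s => 0 < s < 1) (fun s s01 => s01).
apply: filterS3 H1 H2 H01 => s h1 h2 /andP[s0 s1].
rewrite ler_norml; have D0 : 0 <= t2 - t1 by rewrite subr_ge0.
have a1 : 0 <= (t2 - t1) * s by rewrite mulr_ge0// ltW.
have a2 : 0 <= (t2 - t1) * (1 - s) by rewrite mulr_ge0// subr_ge0 ltW.
by apply/andP; split; lra.
Qed.

(** Over [n] equal steps the quadratic errors add up to [C t ^+ 2 / n]. *)
Lemma nonincreasing_of_quadratic (Psi : R -> R) (C t : R) : 0 <= t ->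
  (forall t1 t2, 0 <= t1 -> t1 <= t2 -> Psi t2 <= Psi t1 + C * (t2 - t1) ^+ 2) ->
  Psi t <= Psi 0.
Proof.
move=> t0 H.
have key n : Psi t <= Psi 0 + C * t ^+ 2 * n.+1%:R^-1.
  pose d := t / n.+1%:R; have d0 : 0 <= d by rewrite divr_ge0.
  have step k : Psi (k%:R * d) <= Psi 0 + k%:R * (C * d ^+ 2).
    elim: k => [|k IH]; first by rewrite !mul0r addr0.
    have k0 : 0 <= k%:R * d by rewrite mulr_ge0.
    have kk : k%:R * d <= k.+1%:R * d by rewrite ler_wpM2r// ler_nat.
    apply: le_trans (H _ _ k0 kk) _.
    rewrite -mulrBl -natr1 addrAC subrr add0r mul1r mulrDl mul1r addrA.
    by rewrite lerD2r.
  have := step n.+1; rewrite {1}/d mulrCA divff// mulr1; move/le_trans; apply.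
  rewrite lerD2l le_eqVlt; apply/orP; left; apply/eqP; rewrite /d.
  have : n.+1%:R != 0 :> R by rewrite pnatr_eq0.
  by move: (n.+1%:R : R) => x x0; field.
have cc : Psi 0 + C * t ^+ 2 * n.+1%:R^-1 @[n --> \oo] --> Psi 0 + C * t ^+ 2 * 0.
  apply: cvgD; first exact: cvg_cst.
  by apply: cvgM; [exact: cvg_cst|exact: cvg_harmonic].
rewrite mulr0 addr0 in cc.
by rewrite -(cvg_lim _ cc)//; apply: limr_ge; [apply/cvg_ex; eexists; exact: cc|exact: nearW].
Qed.

Variable h : R.
Let c := Num.max 0 (2 * h).
Let k := posL2 (incrL2 h (g 0)).
(* The positive part [p t] of [P t] is the violation at time [t] of the
   inequality in [solution_modulus]. *)
Let P t := incrL2 h (g t) - (c * t) *: restrL2 h (affL2 1 0) - k.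
Let p t := posL2 (P t).
(* Lipschitz constant in time: each of the two values moves at speed at
   most 2, and the bound itself at speed [c]. *)
Let M := 4 + c.

Let c0 : 0 <= c. Proof. by rewrite le_max lexx. Qed.
Let c2h : 2 * h <= c. Proof. by rewrite le_max lexx orbT. Qed.
Let M0 : 0 <= M. Proof. by rewrite addr_ge0. Qed.

Let PE t s : P t s = if window h s then
  g t (s + h) - g t s - c * t - Num.max 0 (g 0 (s + h) - g 0 s) else 0.
Proof.
have -> : P t s = incrL2 h (g t) s - c * t * restrL2 h (affL2 1 0) s -
  Num.max 0 (incrL2 h (g 0) s) by [].
rewrite !incrL2E restrL2E affL2E mul0r addr0.
by case: ifPn => _; rewrite ?mulr1// mulr0 maxxx !subr0.
Qed.

Let pw t s : ~~ window h s -> p t s = 0.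
Proof. by move=> sw; rewrite posL2E PE (negbTE sw) maxxx. Qed.

Let PB t1 t2 : P t2 - P t1 = incrL2 h (g t2 - g t1) - (c * (t2 - t1)) *: restrL2 h (affL2 1 0).
Proof.
apply/LfuneqP => s.
rewrite L2_subE !PE.
have -> : (incrL2 h (g t2 - g t1) - (c * (t2 - t1)) *: restrL2 h (affL2 1 0)) s =
  incrL2 h (g t2 - g t1) s - c * (t2 - t1) * restrL2 h (affL2 1 0) s by [].
rewrite incrL2E restrL2E affL2E !L2_subE.
by case: ifPn => _; ring.
Qed.

Let P_dist t1 t2 : 0 <= t1 -> t1 <= t2 ->
  {ae m01, forall s, `|P t2 s - P t1 s| <= M * (t2 - t1)}.
Proof.
move=> t10 t12; have d := solution_dist t10 t12.
have D0 : 0 <= t2 - t1 by rewrite subr_ge0.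
have cD0 : 0 <= c * (t2 - t1) by rewrite mulr_ge0.
apply: filterS2 d (ae01_shift h d) => s d1 d2.
rewrite !PE; case: ifPn => [sw|_]; last by rewrite subrr normr0 mulr_ge0.
move: (d2 sw) d1; rewrite !ler_norml /M => /andP[a1 a2] /andP[a3 a4].
by apply/andP; split; lra.
Qed.

Let p_dist t1 t2 : 0 <= t1 -> t1 <= t2 ->
  {ae m01, forall s, `|p t2 s - p t1 s| <= M * (t2 - t1)}.
Proof.
move=> t10 t12; apply: filterS (P_dist t10 t12) => s; rewrite !posL2E.
move: (P t2 s) (P t1 s) => a b; apply: le_trans.
have h1 := ler_norm (a - b); have h2 := ler_norm (- (a - b)); rewrite normrN in h2.
by rewrite ler_norml; case: (leP 0 a) => ?; case: (leP 0 b) => ?; apply/andP; split; lra.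
Qed.

Let shift_bound t1 r v : 0 <= t1 -> t1 <= r ->
  subdifferential (F_ nu) (g r) (- v) ->
  L2inner (shiftL2 (@pw t1) - p t1) v <=
    c * \int[m01]_s p t1 s + (4 + c) * (M * (r - t1)).
Proof.
move=> t10 t1r sub.
have r0 := le_trans t10 t1r.
have B1 : L2inner (shiftL2 (@pw r) - p r) v <= c * \int[m01]_s p r s.
  apply: le_trans (subdifferential_shift (@pw r) sub _ _) _.
  - by move=> s; exact: posL2_ge0.
  - move=> s; rewrite posL2E PE; case: ifPn => _; last by rewrite maxxx eqxx.
    have ct : 0 <= c * r by rewrite mulr_ge0.
    have m0 : 0 <= Num.max 0 (g 0 (s + h) - g 0 s) by rewrite le_max lexx.
    move: (Num.max 0 (g 0 (s + h) - g 0 s)) m0 => m m0.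
    by case: (leP 0 (g r (s + h) - g r s - c * r - m)) => [_ _|_]; [lra|rewrite eqxx].
  - by rewrite ler_wpM2r//; apply: Rintegral_ge0 => s _; exact: posL2_ge0.
(* The velocity at time [r] is compared by convexity along the violation
   at time [r]; the violation at time [t1] differs from it by a multiple
   of [r - t1]. *)
pose q := p t1 - p r.
have qw s : ~~ window h s -> q s = 0.
  by move=> sw; rewrite L2_subE !pw// subrr.
have iq := int01_norm (L2_int q).
have q_int : \int[m01]_s `|q s| <= M * (r - t1).
  have -> : M * (r - t1) = \int[m01]_s (M * (r - t1)).
    by rewrite Rintegral_cst// lebesgue01T mulr1.
  apply: Rint01_le => //; first exact: int01_cst.
  apply: filterS (p_dist t10 t1r) => s Hs.
  by rewrite -[q s]/(p t1 s - p r s) distrC.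
have B2 : L2inner (shiftL2 qw - q) v <= 4 * (M * (r - t1)).
  apply: le_trans (subdifferential_bound _ sub) _.
  have sqE : \int[m01]_s `|shiftL2 qw s| = \int[m01]_s `|q s|.
    rewrite -[RHS](@Rint01_shift _ h (fun s => `|q s|))//.
    - by apply: measurableT_comp => //; exact: L2_meas.
    - by move=> s /qw ->; rewrite normr0.
  have isq := int01_norm (L2_int (shiftL2 qw)).
  apply: (@le_trans _ _ (\int[m01]_s (2 * (`|shiftL2 qw s| + `|q s|)))).
    apply: Rint01_le.
    - apply: int01B; first exact: int01_norm (L2_int _).
      exact: int01_slope (L2_int (shiftL2 qw - q)).
    - by apply: int01Zl; exact: int01D.
    - apply: ae01 => s /andP[s0 s1]; rewrite L2_subE.
      move: (shiftL2 qw s) (q s) => a b.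
      apply: (@le_trans _ _ (2 * `|a - b|)); last by rewrite ler_pM2l// ler_normB.
      have -> : 2 * `|a - b| = `|a - b| + `|a - b| by ring.
      rewrite lerD2l.
      apply: le_trans (ler_norm _) _; rewrite normrN normrM ler_piMl//.
      by rewrite ler_norml; apply/andP; split; lra.
  rewrite RintegralZl//; last exact: int01D.
  by rewrite RintegralD// sqE; lra.
have E : L2inner (shiftL2 (@pw t1) - p t1) v =
    L2inner (shiftL2 (@pw r) - p r) v + L2inner (shiftL2 qw - q) v.
  rewrite !(L2innerC _ v) -L2innerDr; congr L2inner; apply/LfuneqP => s.
  rewrite -[RHS]/((p r (s - h) - p r s) +
    ((p t1 (s - h) - p r (s - h)) - (p t1 s - p r s))).
  rewrite -[LHS]/(p t1 (s - h) - p t1 s).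
  by move: (p t1 (s - h)) (p t1 s) (p r (s - h)) (p r s) => a b x y; ring.
have B3 : \int[m01]_s p r s <= \int[m01]_s p t1 s + M * (r - t1).
  rewrite -lerBlDl -RintegralB//; [|exact: L2_int..].
  apply: le_trans q_int; apply: Rint01_le => //.
    by apply: int01B; exact: L2_int.
  by apply: nearW => s; rewrite L2_subE distrC ler_norm.
rewrite E; apply: le_trans (lerD B1 B2) _.
by rewrite (mulrDl 4 c (M * (r - t1))) [leRHS]addrA [leRHS]addrAC lerD2r -mulrDr ler_wpM2l.
Qed.

Let Psi t := L2inner (p t) (p t).

Let Psi_step t1 t2 : 0 <= t1 -> t1 <= t2 ->
  Psi t2 <= Psi t1 + 3 * M ^+ 2 * (t2 - t1) ^+ 2.
Proof.
move=> t10 t12; pose D := t2 - t1; have D0 : 0 <= D by rewrite subr_ge0.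
have K r v : t1 < r < t2 -> subdifferential (F_ nu) (g r) (- v) ->
    L2inner (shiftL2 (@pw t1) - p t1) v <= c * \int[m01]_s p t1 s + M * (M * D).
  move=> /andP[tr rt] /(shift_bound t10 (ltW tr))/le_trans; apply.
  rewrite lerD2l -/M ler_wpM2l// ler_wpM2l// /D lerD2r ltW//.
have := strong_solution_increment sol t10 t12 K.
rewrite -L2inner_incr -/D => H.
have H2 : L2inner (p t1) (P t2 - P t1) <= M ^+ 2 * D ^+ 2.
  rewrite PB L2innerBr L2innerZr.
  have -> : L2inner (p t1) (restrL2 h (affL2 1 0)) = \int[m01]_s p t1 s.
    apply: eq_Rintegral => s _; rewrite restrL2E affL2E.
    by case: ifPn => [_|/pw->]; rewrite ?mul0r// addr0 mulr1.
  rewrite -/D; move: H; rewrite -/D; set X := L2inner _ _; set Y := \int[_]_s _ => H.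
  by move: H; rewrite !expr2; lra.
have iD := L2_intM (P t2 - P t1) (P t2 - P t1).
have H3 : \int[m01]_s ((P t2 - P t1) s * (P t2 - P t1) s) <= M ^+ 2 * D ^+ 2.
  have -> : M ^+ 2 * D ^+ 2 = \int[m01]_s (M ^+ 2 * D ^+ 2).
    by rewrite Rintegral_cst// lebesgue01T mulr1.
  apply: Rint01_le => //; first exact: int01_cst.
  apply: filterS (P_dist t10 t12) => s Hs.
  rewrite L2_subE -expr2 -exprMn -(real_normK (num_real (_ - _))).
  by rewrite lerXn2r ?nnegrE ?normr_ge0// mulr_ge0.
have i1 := L2_intM (p t1) (p t1).
have i2 := L2_intM (p t1) (P t2 - P t1).
(* The square of the positive part lies below its second order expansion. *)
apply: (@le_trans _ _ (Psi t1 + 2 * L2inner (p t1) (P t2 - P t1) +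
    \int[m01]_s ((P t2 - P t1) s * (P t2 - P t1) s))); last by rewrite -/D; lra.
rewrite /Psi /L2inner -RintegralZl// -RintegralD//; last exact: int01Zl.
rewrite -RintegralD//; last by apply: int01D => //; exact: int01Zl.
apply: Rint01_le; [exact: L2_intM| |].
  by apply: int01D => //; apply: int01D => //; exact: int01Zl.
apply: nearW => s; rewrite !posL2E L2_subE; move: (P t2 s) (P t1 s) => a b.
have a2 := sqr_ge0 a; have b2 := sqr_ge0 b; have ab2 := sqr_ge0 (a - b).
rewrite !expr2 in a2 b2 ab2.
case: (leP 0 a) => a0; case: (leP 0 b) => b0; [lra| |lra|lra].
have : 0 <= a * - b by rewrite mulr_ge0// oppr_ge0 ltW.
lra.
Qed.

(** The square norm [Psi] of the violation vanishes at time 0 and does not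
    increase. For a nondecreasing initial datum, the case [h < 0] says that
    the solution stays nondecreasing in [s], and [h > 0] limits the growth of
    its increments. *)
Lemma solution_modulus (t : R) : 0 <= t -> {ae m01, forall s, window h s ->
  g t (s + h) - g t s <= c * t + Num.max 0 (g 0 (s + h) - g 0 s)}.
Proof.
move=> t0; have := nonincreasing_of_quadratic t0 Psi_step.
have -> : Psi 0 = 0.
  rewrite /Psi /L2inner (_ : (fun s => _) = cst 0).
    by rewrite Rintegral_cst// mul0r.
  apply/funext => s; rewrite posL2E PE mulr0 subr0.
  case: ifPn => _; last by rewrite maxxx mulr0.
  by rewrite (max_idPl _) ?mulr0// subr_le0 le_max lexx orbT.
move=> H; have : L2inner (posL2 (P t)) (P t) <= 0.
  apply: le_trans H; apply: Rint01_le; [exact: L2_intM..|].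
  apply: nearW => s; rewrite posL2E; case: (leP 0 (P t s)) => //.
  by rewrite !mul0r.
move/posL2_inner0; apply: filterS => s; rewrite PE => + sw; rewrite sw.
by lra.
Qed.

End solution.
End monotone.

(** * Functions that do not decrease almost everywhere *)

Section representative.
Context {R : realType}.
Notation m01 := (lebesgue01 R).
Notation mu := (@lebesgue_measure R).

(** A nonempty open interval is not a null set. *)
Lemma ae01_dense (X : R -> Prop) (a b : R) : {ae m01, forall s, X s} ->
  0 <= a -> a < b -> b <= 1 -> exists2 s, a < s < b & X s.
Proof.
move=> [N [mN N0 NX]] a0 ab b1; apply: contrapT => H.
have sub : `]a, b[ `<=` N `&` `]0, 1[.
  move=> s /=; rewrite in_itv/= => sab; split; last first.
    by rewrite /= in_itv/=; case/andP: sab => ? ?; apply/andP; split; lra.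
  by apply: NX => /= Xs; apply: H; exists s.
have : (mu (`]a, b[%classic : set (measurableTypeR R)) <= 0)%E.
  rewrite -N0 lebesgue01E; apply: le_measure; rewrite ?inE//.
  by apply: measurableI => //; exact: measurable_itv.
rewrite leNgt => /negP; apply; rewrite lebesgue_measure_itv/= lte_fin ab -EFinB.
by rewrite lte_fin subr_gt0.
Qed.

Lemma ae01_lebesgue (X : R -> Prop) : {ae mu, forall s, X s} -> {ae m01, forall s, X s}.
Proof.
move=> [N [mN N0 NX]]; exists N; split => //.
apply/eqP; rewrite eq_le measure_ge0 andbT -N0 lebesgue01E le_measure// ?inE//.
by apply: measurableI => //; exact: measurable_itv.
Qed.

Lemma integral01_itv (f : R -> \bar R) : measurable_fun setT f ->
  (forall x, 0 <= f x)%E -> (\int[m01]_x f x = \int[mu]_(x in `]0%R, 1%R[) f x)%E.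
Proof.
move=> mf f0; pose N : set (measurableTypeR R) := ~` `]0, 1[.
have mN : measurable N by apply: measurableC; exact: measurable_itv.
have N0 : m01 N = 0%E by rewrite lebesgue01E setICl measure0.
rewrite (ge0_negligible_integral mN _ _ _ N0)//.
rewrite /N setTD setCK; apply: eq_measure_integral => A mA AD.
by rewrite /= /mrestr setIidl.
Qed.

(** If the inequality failed at two Lebesgue points, then the mean
    oscillations of [w] over small balls around them could not both be small,
    because almost every pair of points at the same distance satisfies it. *)
Lemma nondecreasing_lebesgue_pt (w : R -> R) (x y : R) : measurable_fun setT w ->
  (forall h, 0 < h -> {ae m01, forall s, window h s -> w s <= w (s + h)}) ->
  0 < x -> x < y -> y < 1 ->
  lebesgue_pt (w \_ `]0, 1[) x -> lebesgue_pt (w \_ `]0, 1[) y -> w x <= w y.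
Proof.
set f := w \_ _ => mw wh x0 xy y1 fx fy; rewrite leNgt; apply/negP => wyx.
have mf : measurable_fun setT f by apply/(measurable_restrictT _ _).1 => //; exact: measurable_funTS.
pose e := w x - w y; have e0 : 0 < e by rewrite subr_gt0.
have e20 : 0 < e / 2 by rewrite divr_gt0.
have H : nbhs (0%E : \bar R) (fun u => u < (e / 2)%:E)%E.
  by apply: open_ereal_lt'; rewrite lte_fin.
have Hx : \forall r \near 0^'+, (davg f x r < (e / 2)%:E)%E := fx _ H.
have Hy : \forall r \near 0^'+, (davg f y r < (e / 2)%:E)%E := fy _ H.
near (0 : R)^'+ => r.
have r0 : 0 < r by [].
have rx : r < x by near: r; exact: nbhs_right_lt.
have ry : r < 1 - y by near: r; apply: nbhs_right_lt; rewrite subr_gt0.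
have : (davg f x r < (e / 2)%:E)%E by near: r.
have : (davg f y r < (e / 2)%:E)%E by near: r.
have r20 : 0 < r *+ 2 by rewrite mulrn_wgt0.
have bE (z : R) : ((lebesgue_measure (ball z r : set R))^-1 = ((r *+ 2)^-1)%:E)%E.
  by rewrite lebesgue_measure_ball ?ltW// inver gt_eqF.
rewrite /davg /iavg !bE !lte_pdivrMl// => Iy Ix.
pose h := y - x; have h0 : 0 < h by rewrite subr_gt0.
pose B : set (measurableTypeR R) := ball x r.
have mB : measurable B by exact: measurable_ball.
have Iy' : (\int[mu]_(s in B) `|f (s + h)%R - f y|%:E < (r *+ 2)%:E * (e / 2)%:E)%E.
  apply: le_lt_trans Iy; rewrite le_eqVlt; apply/orP; left; apply/eqP.
  rewrite integral_mkcond [RHS]integral_mkcond.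
  rewrite -[RHS](integral_shift (- h)).
  - apply: eq_integral => s _; rewrite !patchE opprK.
    have -> : (s + h \in (ball y r : set R)) = (s \in B).
      by apply/idP/idP; rewrite !inE /B /ball/= /h; rewrite (_ : y - (s + (y - x)) = x - s)//; ring.
    by [].
  - apply/(measurable_restrictT _ _).1; first exact: measurable_ball.
    apply: measurable_funTS; apply/measurable_EFinP; apply: measurableT_comp => //.
    exact: measurable_funB.
  - by move=> s; rewrite patchE; case: ifPn => // _; rewrite lee_fin.
have muB : (lebesgue_measure (ball x r : set R) = (r *+ 2)%:E)%E.
  by rewrite lebesgue_measure_ball// ltW.
have fE s : 0 < s < 1 -> f s = w s by move=> s01; rewrite /f patchE mem_set//= in_itv/=.
(* The drop [e] from [x] to [y] is at most the sum of the two deviations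
   at any pair of points at distance [h] where [w] does not decrease. *)
have : ((e * (r *+ 2))%:E <= \int[mu]_(s in B) (`|f s - f x|%:E + `|f (s + h)%R - f y|%:E))%E.
  have -> : ((e * (r *+ 2))%:E = \int[mu]_(s in B) (cst e%:E) s)%E.
    by rewrite integral_cst// EFinM -muB.
  apply: ae_ge0_le_integral => //.
  - by move=> s _; rewrite lee_fin ltW.
  - by move=> s _; rewrite adde_ge0// lee_fin.
  - apply: emeasurable_funD; apply/measurable_EFinP; apply: measurable_funTS;
      apply: measurableT_comp => //; apply: measurable_funB => //.
    exact: measurable_shiftr.
  - have [N [mN N0 NX]] := wh h h0.
    exists (N `&` `]0, 1[); split => //.
      by apply: measurableI => //; exact: measurable_itv.
    move=> s /= /not_implyP[Bs nle].
    have s01 : window h s && (0 < s < 1).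
      move: Bs; rewrite /B /ball/= ltr_norml => /andP[s1 s2].
      clear -s1 s2 rx ry x0 xy y1; rewrite /window /h.
      by apply/andP; split; [apply/andP; split|]; apply/andP; split; lra.
    case/andP: s01 => sw s01; split; last by rewrite /= in_itv/=.
    apply: NX => /= wle; apply: nle; rewrite -EFinD lee_fin.
    have := wle sw; have/andP[_ s02] := sw; rewrite !fE//; [|lra..].
    have n1 := ler_norm (w x - w s); rewrite distrC in n1.
    have n2 := ler_norm (w (s + h) - w y).
    rewrite /e; lra.
rewrite ge0_integralD//; last 2 first.
- apply/measurable_EFinP; apply: measurable_funTS; apply: measurableT_comp => //; exact: measurable_funB.
- apply/measurable_EFinP; apply: measurable_funTS; apply: measurableT_comp => //; apply: measurable_funB => //.
  exact: measurable_shiftr.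
rewrite leNgt => /negP; apply.
apply: lt_le_trans (lteD Ix Iy') _.
rewrite -EFinM -EFinD lee_fin le_eqVlt; apply/orP; left; apply/eqP; field.
Unshelve. all: by end_near. Qed.

(** The hypothesis concerns pairs of points, with an exceptional set that
    depends on their distance; the set of Lebesgue points works for all
    distances at once. *)
Lemma L2_nondecreasing_ae (w : L2 R) :
  (forall h, 0 < h -> {ae m01, forall s, window h s -> w s <= w (s + h)}) ->
  exists2 E : R -> Prop, {ae m01, forall s, E s} &
    forall x y, E x -> E y -> 0 < x -> x < y -> y < 1 -> w x <= w y.
Proof.
move=> wh; have mw := L2_meas w.
have iw : mu.-integrable `]0, 1[ (EFin \o (w : R -> R)).
  have /integrableP[_ iw] := L2_int w.
  apply/integrableP; split; first by apply/measurable_EFinP; exact: measurable_funTS.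
  rewrite -integral01_itv//.
  by apply/measurable_EFinP; exact: measurableT_comp.
exists (fun x => lebesgue_pt ((w : R -> R) \_ `]0, 1[) x).
  apply: ae01_lebesgue; apply: lebesgue_differentiation.
  exact: integrable_locally_restrict.
by move=> x y Ex Ey x0 xy y1; apply: nondecreasing_lebesgue_pt wh x0 xy y1 Ex Ey.
Qed.

End representative.

Section extension.
Context {R : realType}.

(** The extension is the supremum of the values to the left. The increments of
    [H] bound those of [u] on a dense set, hence those of the extension
    everywhere, and the continuity of [H] is inherited. *)
Lemma modulus_extension (u H : R -> R) (E : R -> Prop) :
  {in `]0, 1[, continuous H} ->
  (forall a b, 0 <= a -> a < b -> b <= 1 -> exists2 s, a < s < b & E s) ->
  (forall x y, E x -> E y -> 0 < x -> x < y -> y < 1 -> u x <= u y) ->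
  (forall x y, E x -> E y -> 0 < x -> x < y -> y < 1 -> u y - u x <= H y - H x) ->
  exists q : R -> R, [/\ {in `]0, 1[ &, {homo q : x y / x <= y}},
    {in `]0, 1[, continuous q} & forall s, E s -> 0 < s < 1 -> q s = u s].
Proof.
move=> cH dE uE HE.
pose S s : set R := [set u r | r in [set r | E r /\ 0 < r <= s]].
pose q s := sup (S s).
have uE' x y : E x -> E y -> 0 < x -> x <= y -> y < 1 -> u x <= u y.
  move=> Ex Ey x0; rewrite le_eqVlt => /predU1P[<-//|]; exact: uE.
have HE' x y : E x -> E y -> 0 < x -> x <= y -> y < 1 -> u y - u x <= H y - H x.
  move=> Ex Ey x0; rewrite le_eqVlt => /predU1P[<-//|]; [by rewrite !subrr|exact: HE].
have Hmono_dense x y : 0 < x -> x <= y -> y < 1 -> H x <= H y.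
  move=> x0; rewrite le_eqVlt => /predU1P[<-//|xy] y1.
  have Hx : {for x, continuous H} by apply: cH; rewrite in_itv/=; lra.
  have Hy : {for y, continuous H} by apply: cH; rewrite in_itv/=; lra.
  apply/ler_addgt0Pr => e e0.
  have e20 : 0 < e / 2 by rewrite divr_gt0.
  have /cvgrPdist_le/(_ _ e20)/nbhs_ballP[d1 /= d10 D1] := Hx.
  have /cvgrPdist_le/(_ _ e20)/nbhs_ballP[d2 /= d20 D2] := Hy.
  pose d := Num.min (Num.min d1 d2) (y - x).
  have dd : [/\ d <= d1, d <= d2, d <= y - x & 0 < d].
    by rewrite /d !ge_min !lt_min !lexx ?orbT d10 d20 subr_gt0.
  have [dd1 dd2 dxy d0] := dd.
  have [r /andP[xr rd] Er] : exists2 r, x < r < x + d / 2 & E r by apply: dE; lra.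
  have [r' /andP[yr rd'] Er'] : exists2 r, y - d / 2 < r < y & E r by apply: dE; lra.
  have := HE' r r' Er Er'; have := uE' r r' Er Er' => /(_ _ _ _)/wrap[||| h1]; [lra..|].
  move=> /(_ _ _ _)/wrap[||| h2]; [lra..|].
  have := D1 r; rewrite /ball/= => /(_ _)/wrap[|]; first by rewrite distrC gtr0_norm; lra.
  have := D2 r'; rewrite /ball/= => /(_ _)/wrap[|]; first by rewrite gtr0_norm; lra.
  rewrite !ler_norml => /andP[? ?] /andP[? ?]; lra.
have S_sup s : 0 < s < 1 -> has_sup (S s).
  move=> /andP[s0 s1]; split.
    have [r /andP[r0 rs] Er] := dE 0 s (lexx _) s0 (ltW s1).
    by exists (u r), r => //; split=> //; rewrite r0 ltW.
  have [r1 /andP[sr1 r11] Er1] := dE s 1 (ltW s0) s1 (lexx _).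
  exists (u r1) => _ [r [Er /andP[r0 rs]] <-].
  by apply: uE' => //; lra.
have S_le s r : 0 < s < 1 -> E r -> 0 < r <= s -> u r <= q s.
  move=> s01 Er rs; apply: ub_le_sup; first by case: (S_sup s s01).
  by exists r.
have qhomo x y : 0 < x -> x <= y -> y < 1 -> q x <= q y.
  move=> x0 xy y1; have x01 : 0 < x < 1 by lra.
  apply: ge_sup; first by case: (S_sup x x01).
  move=> _ [r [Er /andP[r0 rx]] <-]; apply: S_le => //; lra.
have qH x y : 0 < x -> x <= y -> y < 1 -> q y - q x <= H y - H x.
  move=> x0 xy y1; have x01 : 0 < x < 1 by lra.
  have y01 : 0 < y < 1 by lra.
  rewrite lerBlDr; apply: ge_sup; first by case: (S_sup y y01).
  move=> _ [r [Er /andP[r0 ry]] <-].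
  have Hxy := Hmono_dense x y x0 xy y1.
  have [rx|xr] := leP r x.
    have : u r <= q x by apply: S_le => //; rewrite r0.
    lra.
  have Hx : {for x, continuous H} by apply: cH; rewrite in_itv/=; lra.
  apply/ler_addgt0Pr => e e0.
  have /cvgrPdist_le/(_ _ e0)/nbhs_ballP[d1 /= d10 D1] := Hx.
  pose d := Num.min d1 x.
  have [dd1 dx d0] : [/\ d <= d1, d <= x & 0 < d].
    by rewrite /d !ge_min !lt_min !lexx ?orbT d10 x0.
  have [r' /andP[yr rd'] Er'] : exists2 r, x - d / 2 < r < x & E r by apply: dE; lra.
  have := D1 r'; rewrite /ball/= => /(_ _)/wrap[|]; first by rewrite gtr0_norm; lra.
  rewrite ler_norml => /andP[? ?].
  have : u r' <= q x by apply: S_le => //; lra.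
  have := HE' r' r Er' Er => /(_ _ _ _)/wrap[||| h2]; [lra..|].
  have := Hmono_dense r y r0 ry y1; lra.
exists q; split.
- by move=> x y; rewrite !in_itv/= => /andP[x0 _] /andP[_ y1] xy; exact: qhomo.
- move=> x; rewrite in_itv/= => x01.
  have Hx : {for x, continuous H} by apply: cH; rewrite in_itv/=.
  apply/cvgrPdist_le => /= e e0.
  have /cvgrPdist_le/(_ _ e0) HHx := Hx.
  near=> y.
  have y0 : 0 < y by near: y; apply: lt_nbhsr; case/andP: (x01).
  have y1 : y < 1 by near: y; apply: lt_nbhsl; case/andP: (x01).
  have : `|H x - H y| <= e by near: y.
  rewrite !ler_norml => /andP[e1 e2]; case/andP: (x01) => x0 x1.
  have [xy|/ltW yx] := leP x y.
    have := qhomo x y x0 xy y1; have := qH x y x0 xy y1.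
    by move=> ? ?; apply/andP; split; lra.
  have := qhomo y x y0 yx x1; have := qH y x y0 yx x1.
  by move=> ? ?; apply/andP; split; lra.
- move=> s Es s01; apply/eqP; rewrite eq_le; apply/andP; split.
    apply: ge_sup; first by case: (S_sup s s01).
    by move=> _ [r [Er /andP[r0 rs]] <-]; apply: uE' => //; case/andP: s01.
  by apply: S_le => //; case/andP: s01 => -> _ /=.
Unshelve. all: by end_near. Qed.

End extension.

(** * Measures with a given continuous quantile function *)

Section quantile_of_pushforward.
Context {R : realType}.
Notation m01 := (lebesgue01 R).

Lemma pushforward_probability (f : R -> R) : measurable_fun setT f ->
  exists P : probability (measurableTypeR R) R,
    forall A : set (measurableTypeR R), P A = m01 (f @^-1` A).
Proof.
move=> mf0; have mf : measurable_fun [set: measurableTypeR R]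
  (f : measurableTypeR R -> measurableTypeR R) by exact: mf0.
pose f' : {mfun measurableTypeR R >-> measurableTypeR R} :=
  HB.pack (f : measurableTypeR R -> measurableTypeR R)
    (isMeasurableFun.Build _ _ _ _ _ mf).
have [P0 P0E] : exists P0 : {measure set (measurableTypeR R) -> \bar R},
    P0 = pushforward m01 f' :> (set (measurableTypeR R) -> \bar R).
  by eexists.
have P0T : P0 setT = 1%E by rewrite P0E /pushforward preimage_setT lebesgue01T.
(* The mass is 1, so normalizing changes nothing but the type. *)
exists (mnormalize P0 (dirac (0 : measurableTypeR R))) => A.
rewrite -[LHS]/(mnormalize P0 _ A) /mnormalize P0T onee_eq0/= invr1 mule1.
by rewrite P0E.
Unshelve. exact: mf.
Qed.

(** For continuous nondecreasing [q] the set [{q <= x}] contains [(0, s]]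
    exactly when [q s <= x]. *)
Lemma quantile_pushforward (q : R -> R) (P : probability (measurableTypeR R) R) :
  measurable_fun setT q -> {in `]0, 1[ &, {homo q : x y / x <= y}} -> {in `]0, 1[, continuous q} ->
  (forall A : set (measurableTypeR R), P A = m01 (q @^-1` A)) ->
  {in `]0, 1[, quantile P =1 q}.
Proof.
move=> mq qh qc PE s; rewrite in_itv/= => s01; case/andP: (s01) => s0 s1.
have mqx x : measurable ((q @^-1` `]-oo, x] `&` `]0, 1[) : set (measurableTypeR R)).
  apply: measurableI; last exact: measurable_itv.
  by rewrite -[X in measurable X]setTI; apply: mq => //; exact: measurable_itv.
have mitv (a b : R) : 0 <= a -> a <= b -> b <= 1 -> m01 `]a, b[%classic = (b - a)%:E.
  move=> a0 ab b1; rewrite lebesgue01E setIidl.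
    rewrite lebesgue_measure_itv/= lte_fin; case: ltP => // ba.
    by rewrite (_ : b - a = 0)//; apply/eqP; rewrite subr_eq0 eq_le ab ba.
  by apply: subset_itv; rewrite bnd_simp.
have -> : quantile P s = inf [set x | q s <= x].
  rewrite /quantile; congr inf; apply/seteqP; split => x /=; rewrite /Rplus PE.
  - move=> sle; rewrite leNgt; apply/negP => xq; move: sle; apply/negP; rewrite -ltNge.
    have qsc : {for s, continuous q} by apply: qc; rewrite in_itv/= s01.
    have qx0 : 0 < q s - x by rewrite subr_gt0.
    have /cvgrPdist_lt/(_ _ qx0)/nbhs_ballP[d1 /= d10 D1] := qsc.
    pose d := Num.min d1 s.
    have [dd1 ds d0] : [/\ d <= d1, d <= s & 0 < d].
      by rewrite /d !ge_min !lt_min !lexx ?orbT d10 s0.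
    have xqs : x < q (s - d / 2).
      have := D1 (s - d / 2); rewrite /ball/= => /(_ _)/wrap[|].
        by rewrite gtr0_norm; lra.
      rewrite ltr_norml => /andP[? ?]; lra.
    apply: (@le_lt_trans _ _ (s - d / 2 - 0)%:E); last by rewrite lte_fin; lra.
    rewrite -mitv//; [|lra..].
    rewrite !lebesgue01E; apply: le_measure; rewrite ?inE//.
    + by apply: measurableI; exact: measurable_itv.
    + move=> r /= [qrx]; rewrite !in_itv/= in qrx * => r01; split=> //.
      case/andP: (r01) => r0 r1; rewrite r0/= ltNge; apply/negP => sr.
      have := lt_le_trans xqs (qh (s - d / 2) r _ _ sr); rewrite !in_itv/= r01 => /(_ _ _)/wrap[||].
      * lra.
      * by [].
      * by rewrite ltNge qrx.
  - move=> qsx; rewrite -[s]subr0 -mitv//; [|lra..].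
    rewrite !lebesgue01E; apply: le_measure; rewrite ?inE//.
    + by apply: measurableI; exact: measurable_itv.
    + move=> r /= []; rewrite !in_itv/= => /andP[r0 rs] r01; split => //.
      by rewrite (le_trans _ qsx)// qh ?in_itv//= ltW.
have hl : has_lbound [set x | q s <= x] by exists (q s).
apply/eqP; rewrite eq_le; apply/andP; split; first by apply: ge_inf => //=.
by apply: lb_le_inf => //; exists (q s) => /=.
Qed.

Definition continuous_rep (u : L2 R) (q : R -> R) : Prop :=
  [/\ {in `]0, 1[ &, {homo q : x y / x <= y}}, {in `]0, 1[, continuous q} &
      {ae m01, forall s, u s = q s}].

(** The measure is the law of [q] under the uniform distribution. Cutting [q]
    off outside the unit interval makes it measurable on the whole line. *)
Lemma Dc_continuous_rep (u : L2 R) (q : R -> R) : continuous_rep u q -> Dc u.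
Proof.
move=> [qh qc uq]; pose q0 : R -> R := q \_ `]0, 1[.
have q0E : {in `]0, 1[, q0 =1 q}.
  by move=> s s01; rewrite /q0 patchE mem_set.
have mq0 : measurable_fun setT q0.
  by apply/(measurable_restrictT _ _).1 => //; exact: homo_measurable.
have [P PE] := pushforward_probability mq0.
have q0h : {in `]0, 1[ &, {homo q0 : x y / x <= y}}.
  by move=> x y x01 y01 xy; rewrite !q0E// qh.
have near01 (s : R) : s \in `]0, 1[ -> \forall x \near s, x \in `]0, 1[.
  rewrite in_itv/= => /andP[s0 s1]; near=> x; rewrite in_itv/=; apply/andP; split.
    by near: x; exact: lt_nbhsr.
  by near: x; exact: lt_nbhsl.
have transfer (f1 f2 : R -> R) : {in `]0, 1[, f1 =1 f2} ->
    {in `]0, 1[, continuous f2} -> {in `]0, 1[, continuous f1}.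
  move=> f12 f2c s s01; suff : f1 x @[x --> s] --> f1 s by [].
  rewrite (f12 s s01).
  apply: cvg_trans (f2c s s01); apply: near_eq_cvg.
  by apply: filterS (near01 s s01) => x /f12.
have q0c : {in `]0, 1[, continuous q0} by exact: transfer q0E qc.
have QE : {in `]0, 1[, quantile P =1 q0} by exact: quantile_pushforward mq0 q0h q0c PE.
exists P; split.
- rewrite /finite_second_moment.
  have mq0' : measurable_fun [set: measurableTypeR R]
    (q0 : measurableTypeR R -> measurableTypeR R) by exact: mq0.
  have mx : measurable_fun [set: measurableTypeR R] (fun x : R => (x ^+ 2)%:E).
    by apply/measurable_EFinP; exact: measurable_funX.
  have -> : (\int[P]_x (x ^+ 2)%:E = \int[pushforward m01 (q0 : measurableTypeR R -> measurableTypeR R)]_x (x ^+ 2)%:E)%E.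
    by apply: eq_measure_integral => A mA _; exact: PE.
  rewrite (ge0_integral_pushforward mq0')//; last by move=> x _; rewrite lee_fin sqr_ge0.
  have -> : (\int[m01]_s ((q0 s) ^+ 2)%:E = \int[m01]_s ((u s) ^+ 2)%:E)%E.
    apply: ge0_ae_eq_integral => //.
    + by apply/measurable_EFinP; exact: measurable_funX.
    + by apply/measurable_EFinP; apply: measurable_funX; exact: L2_meas.
    + by move=> s _; rewrite lee_fin sqr_ge0.
    + by move=> s _; rewrite lee_fin sqr_ge0.
    + have H01 := @ae01 R (fun s => 0 < s < 1) (fun s s01 => s01).
      by apply: filterS2 H01 uq => s s01 us _; rewrite us q0E// in_itv.
  exact: integrable_lty (Lfun2_integrable_sqr (L2_mem u)).
- have H01 := @ae01 R (fun s => 0 < s < 1) (fun s s01 => s01).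
  by apply: filterS2 H01 uq => s s01 us _; rewrite us QE ?q0E// in_itv.
- exact: transfer QE q0c.
Unshelve. all: by end_near. Qed.

End quantile_of_pushforward.

(** * Ranges of left-continuous representatives *)

Section ranges.
Context {R : realType}.
Notation m01 := (lebesgue01 R).

(** Two left-continuous functions that differ at a point differ on an interval
    to its left. *)
Lemma left_cont_unique (q1 q2 : R -> R) : {ae m01, forall s, q1 s = q2 s} ->
  {in `]0, 1[, forall s, q1 x @[x --> s^'-] --> q1 s} ->
  {in `]0, 1[, forall s, q2 x @[x --> s^'-] --> q2 s} ->
  {in `]0, 1[, q1 =1 q2}.
Proof.
move=> q12 c1 c2 s s01; apply/eqP; rewrite -subr_eq0; apply: contraT => ne.
have e0 : 0 < `|q1 s - q2 s| by rewrite normr_gt0.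
have cc : (q1 x - q2 x) @[x --> s^'-] --> q1 s - q2 s by apply: cvgB; [exact: c1|exact: c2].
have /cvgrPdist_lt/(_ _ e0) H := cc.
have [d /= d0 Hd] := H.
have [s0 s1] : 0 < s /\ s < 1 by move: s01; rewrite in_itv/= => /andP.
pose d' := Num.min d s.
have [dd ds dp] : [/\ d' <= d, d' <= s & 0 < d'].
  by rewrite /d' !ge_min !lt_min !lexx ?orbT d0 s0.
have [r /andP[r1 r2] rE] : exists2 r, s - d' < r < s & q1 r = q2 r.
  by apply: ae01_dense q12 _ _ _; lra.
have := Hd r; rewrite /ball/= => /(_ _ r2)/wrap[|].
  by rewrite gtr0_norm; lra.
by rewrite rE subrr subr0 ltxx.
Qed.

Lemma left_cont_rep_continuous_rep (u : L2 R) (q : R -> R) : continuous_rep u q ->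
  {in `]0, 1[, left_cont_rep u =1 q}.
Proof.
move=> [qh qc uq].
have ql : {in `]0, 1[, forall s, q x @[x --> s^'-] --> q s}.
  by move=> s s01; apply: cvg_at_left_filter; exact: qc.
have rq : is_left_cont_rep u q by split=> //; apply: filterS uq => s us _.
have [_ rl ru] : is_left_cont_rep u (left_cont_rep u).
  by rewrite /left_cont_rep; case: xgetP => [r -> //|/(_ q)/(_ rq)].
apply: left_cont_unique => //.
by apply: filterS2 uq ru => s us /(_ I) rs; rewrite -rs.
Qed.

(** At levels near 1 the value of [q2] is at least that of [q1] up to a small
    error, at levels near 0 it is at most that of [q1], and the intermediate
    value theorem provides the values in between. *)
Lemma closure_image_le (q1 q2 : R -> R) (D : R) : 0 <= D ->
  {in `]0, 1[ &, {homo q1 : x y / x <= y}} -> {in `]0, 1[, continuous q2} ->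
  {ae m01, forall s, q1 s - 2 * (1 - s) * D <= q2 s <= q1 s + 2 * s * D} ->
  closure (q1 @` `]0, 1[) `<=` closure (q2 @` `]0, 1[).
Proof.
move=> D0 q1h q2c q12.
have -> : closure (q2 @` `]0, 1[) = closure (closure (q2 @` `]0, 1[)).
  by apply/closure_id; exact: closed_closure.
apply: closure_subset => _ [s0 /= s001 <-] B.
move: (s001); rewrite in_itv/= => /andP[s00 s01].
move=> /nbhs_ballP[e /= e0 eB].
pose d := e / (2 * D + 1).
have D1 : 0 < 2 * D + 1 by rewrite ltr_wpDl// mulr_ge0.
have d0 : 0 < d by rewrite divr_gt0.
have dD : 2 * d * D < e.
  have : d * (2 * D + 1) = e by rewrite /d divfK// gt_eqF.
  rewrite mulrDr mulr1; lra.
pose a := Num.max s0 (1 - d).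
have [a1 a2 a3] : [/\ s0 <= a, 1 - d <= a & a < 1].
  by rewrite /a !le_max !gt_max !lexx ?orbT s01/= gtrBl.
have [x /andP[ax x1] /andP[xq _]] := ae01_dense q12 (ltW (lt_le_trans s00 a1)) a3 (lexx _).
pose b := Num.min s0 d.
have [b1 b2 b3] : [/\ b <= s0, b <= d & 0 < b].
  by rewrite /b !ge_min !lt_min !lexx ?orbT s00 d0.
have [y /andP[y0 yb] /andP[_ yq]] := ae01_dense q12 (lexx _) b3 (le_trans b1 (ltW s01)).
have x01 : x \in `]0, 1[ by rewrite in_itv/=; lra.
have y01 : y \in `]0, 1[ by rewrite in_itv/=; lra.
have xlow : q1 s0 - e < q2 x.
  have q1x : q1 s0 <= q1 x by apply: q1h => //; lra.
  have : 2 * (1 - x) * D <= 2 * d * D by rewrite ler_wpM2r//; lra.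
  lra.
have yup : q2 y < q1 s0 + e.
  have q1y : q1 y <= q1 s0 by apply: q1h => //; lra.
  have : 2 * y * D <= 2 * d * D by rewrite ler_wpM2r//; lra.
  lra.
have [xs|sx] := leP (q2 x) (q1 s0).
  exists (q2 x); split; first by exists x.
  by apply: eB; rewrite /ball/= ger0_norm; lra.
have [sy|ys] := leP (q1 s0) (q2 y).
  exists (q2 y); split; first by exists y.
  by apply: eB; rewrite /ball/= ler0_norm; lra.
have yx : y <= x by lra.
have cyx : {within `[y, x], continuous q2}.
  apply: continuous_in_subspaceT => z; rewrite inE/= in_itv/= => /andP[yz zx].
  by apply: q2c; rewrite in_itv/=; lra.
have v : Num.min (q2 y) (q2 x) <= q1 s0 <= Num.max (q2 y) (q2 x).
  by rewrite ge_min le_max (ltW ys) (ltW sx) ?orbT.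
have [z zyx zE] := IVT yx cyx v.
exists (q2 z); split; last by rewrite zE; apply: eB; exact: ballxx.
exists z => //=; move: zyx; rewrite !in_itv/= => /andP[yz zx]; lra.
Qed.

End ranges.

(** * Continuity and growth of the range *)

Section regularity.
Context {R : realType}.
Notation m01 := (lebesgue01 R).
Variables (nu : probability (measurableTypeR R) R) (g0 : L2 R) (g : R -> L2 R).
Hypotheses (g0Dc : Dc g0) (sol : strong_solution (F_ nu) g0 g).

(** Both [g t] and [H - g t], with [H s = 2 t s + g_0 s], are nondecreasing
    along almost all pairs of levels. As [H] is continuous,
    [modulus_extension] applies. *)
Lemma solution_continuous_rep (t : R) : 0 <= t -> exists q, continuous_rep (g t) q.
Proof.
move=> t0; have [mu0 [_ g0Q Qc]] := g0Dc.
have [_ _ gg0 _] := sol.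
pose Q0 := quantile mu0.
have gQ : {ae m01, forall s, g 0 s = Q0 s}.
  by apply: filterS2 gg0 g0Q => s /(_ I) -> /(_ I).
have Q0h := @quantile_homo _ mu0.
have wmod h : {ae m01, forall s, window h s ->
    g t (s + h) - g t s <= Num.max 0 (2 * h) * t + Num.max 0 (Q0 (s + h) - Q0 s)}.
  apply: filterS3 (solution_modulus sol h t0) gQ (ae01_shift h gQ) => s H e1 e2 sw.
  by have := H sw; rewrite e1 (e2 sw).
have wpos h s : 0 < h -> window h s -> Q0 s <= Q0 (s + h).
  move=> h0 /andP[s01 sh01]; apply: Q0h; rewrite ?in_itv//=; lra.
(* Negative increments of the level give monotonicity. *)
have [E1 E1ae E1P] : exists2 E : R -> Prop, {ae m01, forall s, E s} &
    forall x y, E x -> E y -> 0 < x -> x < y -> y < 1 -> g t x <= g t y.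
  apply: L2_nondecreasing_ae => h h0.
  apply: filterS (ae01_shift h (wmod (- h))) => s H sw; move: (H sw).
  have hN0 : 0 <= h by exact: ltW.
  rewrite windowN addrK => /(_ sw).
  rewrite (max_idPl _); last by rewrite mulrN oppr_le0 mulr_ge0.
  rewrite (max_idPl _); last by rewrite subr_le0 wpos.
  by rewrite mul0r addr0 subr_le0.
(* Positive ones give monotonicity of [H - g t]. *)
have [E2 E2ae E2P] : exists2 E : R -> Prop, {ae m01, forall s, E s} &
    forall x y, E x -> E y -> 0 < x -> x < y -> y < 1 ->
      (affL2 0 (2 * t) + g 0 - g t) x <= (affL2 0 (2 * t) + g 0 - g t) y.
  apply: L2_nondecreasing_ae => h h0.
  apply: filterS3 (wmod h) gQ (ae01_shift h gQ) => s H e1 e2 sw.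
  have := H sw; rewrite (max_idPr _); last by rewrite mulr_ge0// ltW.
  rewrite (max_idPr _); last by rewrite subr_ge0 wpos.
  rewrite !L2_subE !L2_addE !affL2E e1 (e2 sw); lra.
pose H s := 2 * t * s + Q0 s.
pose E s := [/\ E1 s, E2 s & g 0 s = Q0 s].
have Eae : {ae m01, forall s, E s} by apply: filterS3 E1ae E2ae gQ.
have Hc : {in `]0, 1[, continuous H}.
  move=> s s01; apply: cvgD; last exact: Qc.
  by apply: cvgM => //; exact: cvg_cst.
have gE x y : E x -> E y -> 0 < x -> x < y -> y < 1 -> g t x <= g t y.
  by move=> [Ex _ _] [Ey _ _]; exact: E1P.
have gH x y : E x -> E y -> 0 < x -> x < y -> y < 1 -> g t y - g t x <= H y - H x.
  move=> [_ Ex ex] [_ Ey ey] x0 xy y1; have := E2P x y Ex Ey x0 xy y1.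
  by rewrite !L2_subE !L2_addE !affL2E ex ey /H; lra.
have Ed a b (a0 : 0 <= a) (ab : a < b) (b1 : b <= 1) := ae01_dense Eae a0 ab b1.
have [q [qh qc qE]] := modulus_extension Hc Ed gE gH.
exists q; split => //.
have H01 := @ae01 R (fun s => 0 < s < 1) (fun s s01 => s01).
by apply: filterS2 H01 Eae => s s01 /qE ->.
Qed.

End regularity.

Theorem theorem6p11 (R : realType) (nu : probability (measurableTypeR R) R)
    (nu2 : finite_second_moment nu) (g0 : L2 R) (g0Dc : Dc g0)
    (g : R -> L2 R) (gsol : strong_solution (F_ nu) g0 g) :
  (forall t : R, 0 <= t -> Dc (g t)) /\
  (forall t1 t2 : R, 0 <= t1 -> t1 <= t2 ->
    closure (left_cont_rep (g t1) @` `]0, 1[) `<=`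
    closure (left_cont_rep (g t2) @` `]0, 1[)).
Proof.
split => [t t0|t1 t2 t10 t12].
  have [q] := solution_continuous_rep g0Dc gsol t0.
  exact: Dc_continuous_rep.
have t20 := le_trans t10 t12.
have [q1 q1r] := solution_continuous_rep g0Dc gsol t10.
have [q2 q2r] := solution_continuous_rep g0Dc gsol t20.
have imE (u : L2 R) (q : R -> R) : continuous_rep u q -> left_cont_rep u @` `]0, 1[ = q @` `]0, 1[.
  by move=> /left_cont_rep_continuous_rep uq; apply: eq_imagel => s /= /uq.
rewrite (imE _ _ q1r) (imE _ _ q2r).
have [q1h _ g1] := q1r; have [_ q2c g2] := q2r.
have D0 : 0 <= t2 - t1 by rewrite subr_ge0.
apply: closure_image_le D0 q1h q2c _.
have n1 : `|-1 : R| = 1 by rewrite normrN normr1.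
have H1 := solution_increment_signed gsol (normr1 R) t10 t12.
have H2 := solution_increment_signed gsol n1 t10 t12.
have H12 : {ae lebesgue01 R, forall s,
    g t1 s - 2 * (1 - s) * (t2 - t1) <= g t2 s <= g t1 s + 2 * s * (t2 - t1)}.
  by apply: filterS2 H1 H2 => s h1 h2; apply/andP; split; lra.
by apply: filterS3 H12 g1 g2 => s h12 <- <-.
Qed.
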